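(* Let $d$ be a (pseudo)metric on $\mathcal R(\Omega,\mathcal X)$ and $(\mathbf X^s,\mathbf U^s)$ a stationary pair with $|\ell(\mathbf X^s,\mathbf U^s)|<\infty$. Assume: (1) the optimal control problem is strictly stochastically dissipative at $(\mathbf X^s,\mathbf U^s)$ with respect to $d$, with storage function $\lambda$ and $\alpha\in\mathcal K_\infty$; (2) there is $r>0$ such that $\lambda$ is uniformly bounded on $\bar B^d_r(\mathbf X^s)$ and $\mathbf X^s$ is cheaply reachable on $\bar B^d_r(\mathbf X^s)$ with constant $C_V$; (3) there exist $\varepsilon>0$ and $\gamma_V:\mathbb R_{\ge0}\times\mathbb R_{\ge0}\to\mathbb R_{\ge0}$ with $\gamma_V(N,\rho)\to0$ as $N\to\infty$ and $\rho\to0$, and with $\gamma_V(\cdot,\rho)$, $\gamma_V(N,\cdot)$ monotone for fixed $\rho$ and $N$, such that $|V_N(j,X_j)-V_N(j,X^s(j))|\le\gamma_V(N,d(X_j,X^s(j)))$ for all $N\in\mathbb N$, $j\in\mathbb N_0$, $X_j\in\bar B^d_\varepsilon(X^s(j))$; (4) $\tilde\ell(j,X^s(j),U^s(j))=0$ for all $j\in\mathbb N_0$; (5) there exist $\tilde r\ge\tilde\varepsilon>0$ and $\gamma_\lambda,\gamma_{\tilde V}\in\mathcal K_\infty$ such that for all $N\in\mathbb N$, $j\in\mathbb N_0$: $|\lambda(j,X_j)-\lambda(j,X^s(j))|\le\gamma_\lambda(d(X_j,X^s(j)))$ for all $X_j\in\bar B^d_{\tilde\varepsilon}(X^s(j))$,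 and $|\tilde V_N(j,X_j)-\tilde V_N(j,X^s(j))|\le\gamma_{\tilde V}(d(X_j,X^s(j)))$ for all $X_j\in\bar B^d_{\tilde r}(X^s(j))$; (6) there exist $\hat\varepsilon>0$ and $\gamma_{V_\infty}\in\mathcal K$ such that $|\hat V_\infty(j,X_j)-\hat V_\infty(j,X^s(j))|\le\gamma_{V_\infty}(d(X_j,X^s(j)))$ for all $j\in\mathbb N_0$, $X_j\in\bar B^d_{\hat\varepsilon}(X^s(j))$. With $\vartheta(L):=\alpha^{-1}\big((C_\lambda+C_\lambda^l+C_V)/L\big)$, where $C_\lambda$ is a uniform bound of $|\lambda|$ on $\bar B^d_r(\mathbf X^s)$ and $-C^l_\lambda$ a uniform lower bound of $\lambda$ ($C_\lambda,C_\lambda^l>0$), set $$\nu(N):=8\gamma_{\tilde V}\big(\vartheta(\tfrac N{12})\big)+4\gamma_\lambda\big(\vartheta(\tfrac N{12})\big)+4\gamma_V\big(\tfrac N2,\vartheta(\tfrac N{12})\big).$$ Then there exist $\theta_0>0$, $N_0\in\mathbb N$ and $\delta\in\mathcal L$ such that for all $N\ge N_0$ the families $\mathcal Y_N(j):=\tilde V_N^{-1}(j,[0,\theta_0])$ and $\mathcal P_N(j):=\tilde V_N^{-1}(j,[0,\delta(N)])$ are forward invariant and $\tilde V_N$ is a uniform time-varying Lyapunov function for the MPC closed loop on $\mathcal Y_N(j)\setminus\mathcal P_N(j)$, and such that for all sufficiently large $N\in\mathbb N$ and all $X_0\in\tilde V_N^{-1}(0,[0,\theta_0])$ the averaged closed-loop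 cost satisfies $$\ell(\mathbf X^s,\mathbf U^s)\le\limsup_{K\to\infty}\frac1KJ^{cl}_K(X_0,\mu_N)\le\ell(\mathbf X^s,\mathbf U^s)+\nu(N).$$
   Context: Setting. $\mathcal X,\mathcal U,\mathcal W$ are separable Banach spaces, $f:\mathcal X\times\mathcal U\times\mathcal W\to\mathcal X$ is continuous, $(\Omega,\mathcal F,\mathbb P)$ is a probability space, and for $\mathcal Z\in\{\mathcal X,\mathcal U,\mathcal W\}$, $\mathcal R(\Omega,\mathcal Z)$ is the set of measurable maps $(\Omega,\mathcal F)\to(\mathcal Z,\mathcal B(\mathcal Z))$. $W(0),W(1),\dots\in\mathcal R(\Omega,\mathcal W)$ are i.i.d. with distribution $P_W$; throughout, the noise acting at any time is independent of the state and the control at that time. $\mathbb U\subseteq\mathcal U$ is a control constraint set. $g:\mathcal X\times\mathcal U\to\mathbb R$ is lower semicontinuous and bounded from below, and $\ell(X,U):=\mathbb E[g(X,U)]$. Optimal control problem. For $j\in\mathbb N_0$, $X_j\in\mathcal R(\Omega,\mathcal X)$ and a control sequence $\mathbf U=(U(0),U(1),\dots)$, $X_{\mathbf U}(0;j,X_j)=X_j$, $X_{\mathbf U}(k+1;j,X_j)=f(X_{\mathbf U}(k;j,X_j),U(k),W(j+k))$. $\mathbb U_{ad}(X):=\{U\in\mathcal R(\Omega,\mathcal U):\sigma(U)\subseteq\sigma(X),\ U(\omega)\in\mathbb U\ \forall\omega\}$; $\mathbb U^N_{ad}(j,X_j)$ ($N\in\mathbb N\cup\{\infty\}$) is the set of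 control sequences with $U(k)\in\mathbb U_{ad}(X_{\mathbf U}(k;j,X_j))$ for all $0\le k\le N-1$. $J_N(j,X_j,\mathbf U):=\sum_{k=0}^{N-1}\ell(X_{\mathbf U}(k;j,X_j),U(k))$, $V_N(j,X_j):=\inf_{\mathbf U\in\mathbb U^N_{ad}(j,X_j)}J_N(j,X_j,\mathbf U)$, $V_0\equiv0$. Minimizers are denoted $\mathbf U^*_{N}=\mathbf U^*_{N,j,X_j}$; minimizers are assumed to exist whenever they are referred to. MPC feedback: $\mu_N(X_j):=U^*_{N,j,X_j}(0)$, the first element of an optimal control sequence at time $j$ and state $X_j$ (any choice of minimizer). $X_{\mu_N}(\cdot;0,X_0)$ is the closed-loop trajectory: $X_{\mu_N}(0;0,X_0)=X_0$, $X_{\mu_N}(j+1;0,X_0)=f(X,\mu_N(X),W(j))$ with $X=X_{\mu_N}(j;0,X_0)$. $J_K^{cl}(X_0,\mu_N):=\sum_{j=0}^{K-1}\ell(X_{\mu_N}(j;0,X_0),\mu_N(X_{\mu_N}(j;0,X_0)))$. A family $\mathcal Y(j)\subseteq\mathcal R(\Omega,\mathcal X)$ is forward invariant if $f(X_j,\mu_N(X_j),W(j))\in\mathcal Y(j+1)$ for all $X_j\in\mathcal Y(j)$, $j\in\mathbb N_0$. Stationary pair: processes $(\mathbf X^s,\mathbf U^s)$ with $X^s(k+1)=f(X^s(k),U^s(k),W(k))$, $\mathbf U^s\in\mathbb U^\infty_{ad}(0,X^s(0))$, such that the laws of $X^s(k)$, $U^s(k)$ and $(X^s(k),U^s(k))$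 do not depend on $k\in\mathbb N_0$; $\ell(\mathbf X^s,\mathbf U^s)$ denotes the constant value $\ell(X^s(k),U^s(k))$. (Pseudo)metrics $d:\mathcal R(\Omega,\mathcal X)^2\to[0,\infty]$ may take the value $\infty$. $\bar B^d_r(X^s(j)):=\{X\in\mathcal R(\Omega,\mathcal X):d(X,X^s(j))\le r\}$, $\bar B^d_r(\mathbf X^s):=\{(j,X_j):j\in\mathbb N_0,\ X_j\in\bar B^d_r(X^s(j))\}$. Comparison functions on $[0,\infty)$: $\mathcal K$: continuous, strictly increasing, zero at $0$; $\mathcal K_\infty$: unbounded functions in $\mathcal K$; $\mathcal L$: continuous, strictly decreasing to $0$. Strict stochastic dissipativity at $(\mathbf X^s,\mathbf U^s)$ w.r.t. $d$: there are a storage function $\lambda:\mathbb N_0\times\mathcal R(\Omega,\mathcal X)\to\mathbb R$, uniformly bounded from below, and $\alpha\in\mathcal K_\infty$ with $$\tilde\ell(j,X,U):=\ell(X,U)-\ell(\mathbf X^s,\mathbf U^s)+\lambda(j,X)-\lambda(j+1,f(X,U,W(j)))\ge\alpha(d(X,X^s(j)))$$ for all $j\in\mathbb N_0$, $X\in\mathcal R(\Omega,\mathcal X)$, $U\in\mathbb U_{ad}(X)$. Cheap reachability on $\bar B^d_r(\mathbf X^s)$ with constant $C_V>0$: $V_N(j,X_j)-N\ell(\mathbf X^s,\mathbf U^s)\le C_V$ for all $(j,X_j)\in\bar B^d_r(\mathbf X^s)$, $N\in\mathbb N$. Modified problem: $\tilde J_N(j,X_j,\mathbf U):=\sum_{k=0}^{N-1}\tilde\ell(j+k,X_{\mathbf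 U}(k;j,X_j),U(k))$, $\tilde V_N(j,X_j):=\inf_{\mathbf U\in\mathbb U^N_{ad}(j,X_j)}\tilde J_N(j,X_j,\mathbf U)$, $\tilde V_N^{-1}(j,[0,a]):=\{X\in\mathcal R(\Omega,\mathcal X):\tilde V_N(j,X)\in[0,a]\}$. Shifted problem: $\hat\ell(X,U):=\ell(X,U)-\ell(\mathbf X^s,\mathbf U^s)$, $\hat J_N(j,X_j,\mathbf U):=\sum_{k=0}^{N-1}\hat\ell(X_{\mathbf U}(k;j,X_j),U(k))$ and $\hat V_N(j,X_j):=\inf_{\mathbf U\in\mathbb U^N_{ad}(j,X_j)}\hat J_N(j,X_j,\mathbf U)$ for $N\in\mathbb N\cup\{\infty\}$ (infinite sums are limits of partial sums). Uniform time-varying Lyapunov function on $\mathcal S(j)\subseteq\mathcal R(\Omega,\mathcal X)$, $j\in\mathbb N_0$: a function $V:\{(j,X_j):j\in\mathbb N_0,X_j\in\mathcal S(j)\}\to[0,\infty)$ for which there are $\alpha_1,\alpha_2\in\mathcal K_\infty$, $\alpha_V\in\mathcal K$ such that (i) $\alpha_1(d(X_j,X^s(j)))\le V(j,X_j)\le\alpha_2(d(X_j,X^s(j)))$ and (ii) $V(j+1,f(X_j,\mu_N(X_j),W(j)))\le V(j,X_j)-\alpha_V(d(X_j,X^s(j)))$ hold for all $j\in\mathbb N_0$ and all $X_j\in\mathcal S(j)$ with $f(X_j,\mu_N(X_j),W(j))\in\mathcal S(j+1)$. *)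

(* Defs.v *)
From HB Require Import structures.
From mathcomp Require Import all_boot all_order all_algebra.
From mathcomp Require Import all_classical all_reals all_analysis.

Set Implicit Arguments.
Unset Strict Implicit.
Unset Printing Implicit Defensive.

Import Order.TTheory GRing.Theory Num.Theory.
Import numFieldNormedType.Exports.

Local Open Scope classical_set_scope.
Local Open Scope ring_scope.

Definition separable (T : topologicalType) :=
  exists2 D : set T, countable D & dense D.

Notation borel T := (g_sigma_algebraType (@open T)).

Section comparison_functions.
Context {R : realType}.
Implicit Types a : R -> R.

Definition classK a :=
  [/\ {within `[0, +oo[, continuous a},
      {in `[0, +oo[ &, {homo a : x y / x < y}} & a 0 = 0].

Definition classKoo a :=
  classK a /\ forall M, exists2 x, 0 <= x & M < a x.

Definition classL a :=
  [/\ {within `[0, +oo[, continuous a},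
      {in `[0, +oo[ &, {homo a : x y /~ x < y}} & a x @[x --> +oo] --> 0].

(* Comparison functions are evaluated at distances, which may be +oo; the
   convention is a(+oo) = +oo, the continuous extension when a is of class
   K_oo.  The value at -oo is never used. *)
Definition cmp_ext a (t : \bar R) : \bar R :=
  if t is r%:E then (a r)%:E else t.

End comparison_functions.

(* Extended pseudometric on a set D of a type. *)
Record pseudometric_on {R : realType} {T : Type} (D : set T)
    (d : T -> T -> \bar R) : Prop := {
  pm_ge0 : forall x y, D x -> D y -> (0 <= d x y)%E ;
  pm_xx : forall x, D x -> d x x = 0%E ;
  pm_sym : forall x y, D x -> D y -> d x y = d y x ;
  pm_triangle : forall x y z, D x -> D y -> D z ->
    (d x z <= d x y + d y z)%E }.

Section random_variables.
Context {R : realType} {dO : measure_display} {Om : measurableType dO}.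
Variable P : probability Om R.

(* The set R(Om, T) of Borel measurable maps. *)
Definition RV (T : normedModType R) : set (Om -> T) :=
  [set X | measurable_fun setT (X : Om -> borel T)].

(* sigma(X), the sigma-algebra generated by X. *)
Definition sigma (T : normedModType R) (X : Om -> T) : set (set Om) :=
  g_sigma_algebra_preimage (X : Om -> borel T).

Definition indep_RV (T T' : normedModType R) (X : Om -> T) (Y : Om -> T') :=
  forall A B, sigma X A -> sigma Y B -> P (A `&` B) = (P A * P B)%E.

Definition same_law (T : normedModType R) (X Y : Om -> T) :=
  forall A : set (borel T), measurable A -> P (X @^-1` A) = P (Y @^-1` A).

Definition iid (T : normedModType R) (Z : nat -> Om -> T)
    (Q : probability (borel T) R) :=
  [/\ forall k, RV (Z k),
      forall k (A : set (borel T)), measurable A -> P (Z k @^-1` A) = Q A &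
      forall (s : seq nat) (A : nat -> set (borel T)), uniq s ->
        (forall i, measurable (A i)) ->
        P (\bigcap_(i in [set` s]) (Z i @^-1` A i)) =
        (\prod_(i <- s) P (Z i @^-1` A i))%E].

End random_variables.

Record stoch_ocp {R : realType} {dO : measure_display}
    (Om : measurableType dO) (SX SU SW : completeNormedModType R) := StochOCP {
  prob : probability Om R ;
  dyn : SX * SU * SW -> SX ;          (* f *)
  stage : SX * SU -> R ;              (* g *)
  constr : set SU ;                   (* control constraint set *)
  noise : nat -> Om -> SW ;           (* W(0), W(1), ... *)
  noise_law : probability (borel SW) R (* P_W *) }.

Section optimal_control.
Context {R : realType} {dO : measure_display} {Om : measurableType dO}
  {SX SU SW : completeNormedModType R}.
Variable S : stoch_ocp Om SX SU SW.

Local Notation P := (prob S).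
Local Notation state := (Om -> SX).
Local Notation control := (Om -> SU).

Definition standing :=
  [/\ [/\ separable SX, separable SU & separable SW],
      continuous (dyn S),
      lower_semicontinuous (fun z => (stage S z)%:E),
      exists m, forall z, m <= stage S z &
      iid P (noise S) (noise_law S)].

Definition step (j : nat) (X : state) (U : control) : state :=
  fun w => dyn S (X w, U w, noise S j w).

(* X_U(k; j, X) *)
Fixpoint traj (j : nat) (X : state) (U : nat -> control) (k : nat) : state :=
  if k is k'.+1 then step (j + k') (traj j X U k') (U k') else X.

Definition Uad (X : state) : set control :=
  [set U | [/\ RV U, sigma U `<=` sigma X & forall w, constr S (U w)]].

(* Control sequences that are admissible at the steps k in K: K = `I_N is the
   finite horizon N, K = setT the infinite horizon. *)
Definition Uads (K : set nat) (j : nat) (X : state) : set (nat -> control) :=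
  [set U | forall k, K k -> Uad (traj j X U k) (U k)].

(* The states X in R(Om, SX) allowed at time j: from (j, X) onwards, under
   every admissible control sequence, the noise acting at any time is
   independent of the state and the control at that time.  This set replaces
   R(Om, SX) as the range of the state at time j: a state that anticipates
   W(j), W(j+1), ... violates the standing independence assumption. *)
Definition states (j : nat) : set state :=
  [set X | RV X /\
    forall U, Uads setT j X U -> forall k,
      indep_RV P ((fun w => (traj j X U k w, U k w)) : Om -> (SX * SU)%type)
        (noise S (j + k))].

(* l(X, U) = E[g(X, U)], with values in ]-oo, +oo] as g is bounded below. *)
Definition cost (X : state) (U : control) : \bar R :=
  'E_P[(fun w => stage S (X w, U w))].

Definition J (N j : nat) (X : state) (U : nat -> control) : \bar R :=
  (\sum_(k < N) cost (traj j X U k) (U k))%E.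

Definition V (N j : nat) (X : state) : \bar R :=
  ereal_inf [set J N j X U | U in Uads `I_N j X].

(* mu N is an MPC feedback mu_N: it maps (j, X) to the first element of some
   minimizer of the problem with horizon N started in X at time j. *)
Definition mpc_feedback (mu : nat -> nat -> state -> control) :=
  forall N j X, (0 < N)%N -> states j X ->
    exists U, [/\ Uads `I_N j X U, J N j X U = V N j X & mu N j X = U 0%N].

Section pair.
Variables (Xs : nat -> state) (Us : nat -> control).

Definition stationary_pair :=
  [/\ states 0 (Xs 0%N),
      forall k, Xs k.+1 = step k (Xs k) (Us k),
      Uads setT 0 (Xs 0%N) Us &
      forall k, [/\ same_law P (Xs k) (Xs 0%N),
        same_law P (Us k) (Us 0%N) &
        same_law P ((fun w => (Xs k w, Us k w)) : Om -> (SX * SU)%type)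
          (fun w => (Xs 0%N w, Us 0%N w))]].

(* l(Xs, Us), the value of l(Xs k, Us k), independent of k. *)
Definition stat_cost : \bar R := cost (Xs 0%N) (Us 0%N).

Definition mod_cost (lam : nat -> state -> R) (j : nat) (X : state)
    (U : control) : \bar R :=
  (cost X U - stat_cost + (lam j X)%:E - (lam j.+1 (step j X U))%:E)%E.

Definition mod_J (lam : nat -> state -> R) (N j : nat) (X : state)
    (U : nat -> control) : \bar R :=
  (\sum_(k < N) mod_cost lam (j + k) (traj j X U k) (U k))%E.

Definition mod_V (lam : nat -> state -> R) (N j : nat) (X : state) : \bar R :=
  ereal_inf [set mod_J lam N j X U | U in Uads `I_N j X].

Definition mod_V_sublevel (lam : nat -> state -> R) (N j : nat) (a : R) :
    set state :=
  [set X | states j X /\ (0 <= mod_V lam N j X <= a%:E)%E].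

Definition shift_cost (X : state) (U : control) : \bar R :=
  (cost X U - stat_cost)%E.

(* The sum is the limit of the partial sums; that limit exists in \bar R for
   every admissible sequence when the problem is strictly dissipative, mod_cost
   vanishes along (Xs, Us) and lam is continuous at Xs uniformly in time. *)
Definition shift_Joo (j : nat) (X : state) (U : nat -> control) : \bar R :=
  (\sum_(0 <= k <oo) shift_cost (traj j X U k) (U k))%E.

Definition shift_Voo (j : nat) (X : state) : \bar R :=
  ereal_inf [set shift_Joo j X U | U in Uads setT j X].

Variable d : state -> state -> \bar R.

Definition Bbar (r : R) (j : nat) : set state :=
  [set X | states j X /\ (d X (Xs j) <= r%:E)%E].

(* Strict dissipativity with storage function lam >= - Cl. *)
Definition strictly_dissipative (lam : nat -> state -> R) (Cl : R)
    (alpha : R -> R) :=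
  [/\ classKoo alpha,
      forall j X, states j X -> - Cl <= lam j X &
      forall j X U, states j X -> Uad X U ->
        (cmp_ext alpha (d X (Xs j)) <= mod_cost lam j X U)%E].

Definition cheaply_reachable (r CV : R) :=
  forall N j X, (0 < N)%N -> Bbar r j X ->
    (V N j X - N%:R%:E * stat_cost <= CV%:E)%E.

Definition forward_invariant (mu : nat -> state -> control)
    (Y : nat -> set state) :=
  forall j X, Y j X -> Y j.+1 (step j X (mu j X)).

Definition unif_lyapunov (mu : nat -> state -> control)
    (Y : nat -> set state) (L : nat -> state -> \bar R) :=
  (forall j X, Y j X -> (0 <= L j X < +oo)%E) /\
  exists a1 a2 aV : R -> R,
    [/\ classKoo a1, classKoo a2, classK aV &
     forall j X, Y j X -> Y j.+1 (step j X (mu j X)) ->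
       (cmp_ext a1 (d X (Xs j)) <= L j X <= cmp_ext a2 (d X (Xs j)))%E /\
       (L j.+1 (step j X (mu j X)) <= L j X - cmp_ext aV (d X (Xs j)))%E].

End pair.

Section closed_loop.
Variable mu : nat -> state -> control.

Fixpoint cl_traj (X0 : state) (j : nat) : state :=
  if j is j'.+1 then step j' (cl_traj X0 j') (mu j' (cl_traj X0 j')) else X0.

Definition Jcl (K : nat) (X0 : state) : \bar R :=
  (\sum_(j < K) cost (cl_traj X0 j) (mu j (cl_traj X0 j)))%E.

End closed_loop.

End optimal_control.

Section rates.
Context {R : realType}.

(* alpha^-1 (C / L), alpha^-1 being the inverse of alpha on [0, +oo[. *)
Definition vartheta (alpha : R -> R) (C L : R) : R :=
  pinv (`[0, +oo[%classic : set R) alpha (C / L).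

Definition nu (gtV glam : R -> R) (gV : R -> R -> R) (th : R -> R) (N : nat) :=
  8 * gtV (th (N%:R / 12)) + 4 * glam (th (N%:R / 12))
  + 4 * gV (N%:R / 2) (th (N%:R / 12)).

(* gamma_V(N, rho) -> 0 as N -> +oo and rho -> 0, monotone in each variable;
   the directions are those of the two limits: nonincreasing in N and
   nondecreasing in rho. *)
Definition horizon_gain (g : R -> R -> R) :=
  [/\ forall n rho, 0 <= n -> 0 <= rho -> 0 <= g n rho,
      g p.1 p.2 @[p --> (+oo, (0:R)^'+)] --> 0,
      forall rho, 0 <= rho -> {in `[0, +oo[ &, {homo g^~ rho : m n /~ m <= n}} &
      forall n, 0 <= n -> {in `[0, +oo[ &, {homo g n : s t / s <= t}}].

End rates.

(* Main.v *)
Require Import Defs.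
From HB Require Import structures.
From mathcomp Require Import all_boot all_order all_algebra.
From mathcomp Require Import all_classical all_reals all_analysis.
From mathcomp Require Import ring lra zify.
Set Implicit Arguments.
Unset Strict Implicit.
Unset Printing Implicit Defensive.

Import Order.TTheory GRing.Theory Num.Theory.
Import numFieldNormedType.Exports.
Local Open Scope classical_set_scope.
Local Open Scope ring_scope.

(** Write V for the optimal value, Vt for the optimal value of the modified
    problem, ct >= alpha (d (X, Xs j)) for the modified stage cost and X+ for
    the successor of X under the MPC feedback mu_N. Everything follows from one
    inequality ([mod_V_decrease]): for large N and X near the stationary process,

      Vt_N (j + 1, X+) + ct (j, X, mu_N X) <= Vt_N (j, X) + nu N.

    The modified cost differs from the original one by a telescoping sum of
    storage terms. Cheap reachability therefore bounds the modified cost of a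
    sequence U that is optimal for V_N by a constant C = Clam + Cl + CV that does
    not depend on N, and the same bound can be imposed on a near-minimizer U' of
    the modified problem. Since the modified stage costs are nonnegative, a
    pigeonhole argument ([common_near_time]) yields one time m <= N / 2 at which
    both of them are at most 12 C / N, so that both trajectories are within
    rho = vartheta (N / 12) of the stationary process. From there on both have
    the same optimal value up to gV (N / 2) rho, hence the optimality of U
    makes the prefix of U up to time m nearly as cheap as that of U'
    ([optimal_prefix]). Finally the prefix of U, shifted by one step and
    continued at modified cost at most gtV rho, is a competitor for
    Vt_N (j + 1, X+).

    Given the inequality, the function Vt_N lies between alpha and gtV of the
    distance and decreases along the closed loop as long as alpha of the distance
    exceeds nu N. The latter holds above the level
    gtV (alpha^-1 (2 nu N)) + nu N, which tends to 0 as N grows and is dominated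
    by a class L function delta ([classL_dominating]). This gives the invariance of
    the level sets and the Lyapunov property; summing the inequality along the
    closed loop gives the averaged cost. *)

(** * Comparison functions and null sequences *)

Section comparison_function_theory.
Context {R : realType}.
Implicit Types a : R -> R.

Lemma classK_ler a x y : classK a -> 0 <= x -> 0 <= y ->
  (a x <= a y) = (x <= y).
Proof.
move=> [_ a_incr _] x0 y0.
by apply: (le_mono_in a_incr); rewrite in_itv/= andbT.
Qed.

Lemma classK_ge0 a x : classK a -> 0 <= x -> 0 <= a x.
Proof. by move=> aK x0; have [_ _ <-] := aK; rewrite classK_ler. Qed.

Lemma classK_gt0 a x : classK a -> 0 < x -> 0 < a x.
Proof.
by move=> aK x0; have [_ _ <-] := aK; rewrite ltNge classK_ler -?ltNge// ltW.
Qed.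

Lemma classK_small a e : classK a -> 0 < e -> exists2 h, 0 < h & a h <= e.
Proof.
move=> aK e0; have [/continuous_within_itvcyP[_ a_cont] _ a00] := aK.
have [h h0 /= small_h] := (cvgrPdist_le _ _).1 a_cont e e0.
have h2 : 0 < h / 2 by rewrite divr_gt0.
exists (h / 2) => //; have /= := small_h (h / 2).
rewrite a00 !sub0r !normrN (gtr0_norm h2) (ger0_norm (classK_ge0 aK (ltW h2))).
by apply; rewrite // ltr_pdivrMr// mulr_natr mulr2n ltrDl.
Qed.

Lemma classK_scale a c : 0 < c -> classK a -> classK (fun x => c * a x).
Proof.
move=> c0 [a_cont a_incr a00]; split; last by rewrite a00 mulr0.
  by move=> x; apply: cvgM; [exact: cvg_cst|exact: a_cont].
by move=> x y x0 y0 xy; rewrite ltr_pM2l// a_incr.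
Qed.

Lemma classK_cvg0 a (u : R^nat) : classK a -> (forall n, 0 <= u n) ->
  u @ \oo --> 0 -> a \o u @ \oo --> 0.
Proof.
move=> aK u0 ucvg; apply/cvgrPdist_le => e e0.
have [h h0 ah] := classK_small aK e0.
near=> n; rewrite sub0r normrN ger0_norm ?classK_ge0//=.
apply: le_trans ah; rewrite classK_ler ?(ltW h0)//.
rewrite -[leLHS]ger0_norm// -[`|u n|]normrN -[- u n]sub0r; near: n.
exact: (cvgrPdist_le _ _).1 ucvg h h0.
Unshelve. all: by end_near. Qed.

(** The function [vartheta alpha C] of the error bound maps L to
    [kinv alpha (C / L)]. *)
Definition kinv a : R -> R := pinv (`[0, +oo[%classic : set R) a.

(** The intermediate value theorem on [0, b], with b such that y < a b, makes
    [kinv a] a genuine inverse on all of [0, +oo[. *)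
Lemma kinvP a y : classKoo a -> 0 <= y -> 0 <= kinv a y /\ a (kinv a y) = y.
Proof.
move=> [aK a_unb] y0.
have [b b0 yb] := a_unb y.
have [a_cont _ a00] := aK.
have [] := @IVT R a 0 b y b0.
- apply: continuous_subspaceW a_cont => x /=.
  by rewrite !in_itv/= => /andP[->].
- by rewrite a00 ge_min y0/= le_max (ltW yb) orbT.
move=> c; rewrite in_itv/= => /andP[c0 _] acy.
have yim : y \in a @` `[0, +oo[.
  by rewrite inE; exists c => //=; rewrite in_itv/= c0.
split; last exact: pinvK.
have : `[0, +oo[%classic (kinv a y).
  by apply: (@surjpinv_image_sub _ _ _ _ (a @` `[0, +oo[) a) => //;
    exists y => //; exact/set_mem.
by rewrite /= in_itv/= andbT.
Qed.

Lemma kinv_le a x y : classKoo a -> 0 <= y -> 0 <= x ->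
  (kinv a y <= x) = (y <= a x).
Proof.
move=> aK y0 x0; have [v0 {2}<-] := kinvP aK y0.
by rewrite classK_ler//; case: aK.
Qed.

Lemma kinv_cvg0 a (u : R^nat) : classKoo a -> (forall n, 0 <= u n) ->
  u @ \oo --> 0 -> kinv a \o u @ \oo --> 0.
Proof.
move=> aK u0 ucvg; apply/cvgrPdist_le => e e0.
have ae : 0 < a e by apply: classK_gt0 => //; case: aK.
near=> n; rewrite sub0r normrN ger0_norm/=; last by have [] := kinvP aK (u0 n).
rewrite kinv_le// ?(ltW e0)// -[leLHS]ger0_norm// -[`|u n|]normrN -[- u n]sub0r.
near: n; exact: (cvgrPdist_le _ _).1 ucvg _ ae.
Unshelve. all: by end_near. Qed.

Lemma one_sided_lipschitz_continuous (B : R) (f : R -> R) (x : R) :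
  (forall y z, f y <= f z + B * `|y - z|) -> {for x, continuous f}.
Proof.
move=> fB.
have fB' y : `|f x - f y| <= (`|B| + 1) * `|x - y|.
  have := fB x y; have := fB y x; rewrite (distrC y x) => h1 h2.
  have : B * `|x - y| <= (`|B| + 1) * `|x - y|.
    by apply: ler_wpM2r => //; rewrite (le_trans (ler_norm B))// lerDl.
  by move: (B * _) ((_ + 1) * _) h1 h2 => u v h1 h2 uv; rewrite ler_norml; lra.
apply/cvgrPdist_le => e e0.
have B0 : 0 < `|B| + 1 by rewrite ltr_wpDl.
near=> y; apply: le_trans (fB' y) _; rewrite mulrC -ler_pdivlMr//.
near: y; apply: (cvgrPdist_le _ _).1; first exact: cvg_id.
exact: divr_gt0.
Unshelve. all: by end_near. Qed.

(** The function is an upper envelope: each value s n is spread to the right by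
    the kernel w, which is 1 up to n and decays like the inverse of the distance
    beyond n. The kernel is 1-Lipschitz, so the supremum over n inherits
    continuity from the bound on s; it tends to 0 because only the finitely many
    large terms contribute more than e, and each of them decays. The summand w x
    makes the envelope strictly decreasing. *)
Lemma classL_dominating (s : R^nat) : (forall n, 0 <= s n) -> s @ \oo --> 0 ->
  exists2 f : R -> R, classL f & forall n, s n <= f n%:R.
Proof.
move=> s0 scvg.
have [B B0 sB] : exists2 B : R, 0 < B & forall n, s n <= B.
  have /cvg_seq_bounded/pinfty_ex_gt0[B B0 /= sB] : cvgn s.
    by apply/cvg_ex; exists 0.
  by exists B => // n; apply: le_trans (ler_norm _) (sB n I).
pose w (t : R) : R := (1 + Num.max 0 t)^-1.
have w1 (t : R) : 0 < 1 + Num.max 0 t by rewrite ltr_wpDr// le_max lexx.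
have w0 t : 0 < w t by rewrite invr_gt0.
have w_noninc t t' : t <= t' -> w t' <= w t.
  move=> tt'; rewrite lef_pV2 ?posrE// lerD2l.
  by rewrite ge_max le_max lexx/= le_max tt' orbT.
have w_lip t t' : w t <= w t' + `|t - t'|.
  have [tt'|t't] := leP t' t.
    by apply: le_trans (w_noninc _ _ tt') _; rewrite lerDl.
  have p1 : 1 <= 1 + Num.max 0 t by rewrite lerDl le_max lexx.
  have q1 : 1 <= 1 + Num.max 0 t' by rewrite lerDl le_max lexx.
  have pq : `|Num.max 0 t' - Num.max 0 t| <= t' - t.
    by rewrite /Num.max; case: ifPn => h1; case: ifPn => h2;
      rewrite ler_norml; lra.
  rewrite distrC (ger0_norm (x := t' - t)) ?subr_ge0 ?(ltW t't)//.
  apply: le_trans (lerD (lexx _) (le_trans (ler_norm _) pq)).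
  rewrite -lerBlDl /w; move: p1 q1 => {pq}.
  have -> : Num.max 0 t' - Num.max 0 t = 1 + Num.max 0 t' - (1 + Num.max 0 t).
    by ring.
  have : 1 + Num.max 0 t <= 1 + Num.max 0 t'.
    by rewrite -lef_pV2 ?posrE//; exact/w_noninc/ltW.
  move: (1 + _) (1 + _) => q p pq p1 q1.
  have -> : p^-1 - q^-1 = (q - p) * (p * q)^-1 by field; lra.
  by rewrite ler_piMr ?subr_ge0// invf_le1; nra.
(* k x n is the contribution of s n at x, and f is the envelope *)
pose k x n := s n * w (x - n%:R).
pose f x := sup (range (k x)).
have k_ub x : ubound (range (k x)) B.
  move=> _ [n _ <-]; apply: le_trans (sB n); rewrite ler_piMr//.
  by rewrite invf_le1// lerDl le_max lexx.
have k_le_f x n : k x n <= f x.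
  by apply: ub_le_sup; [exists B|exists n].
have f_le x c : (forall n, k x n <= c) -> f x <= c.
  by move=> kc; apply: ge_sup; [exists (k x 0%N), 0%N|move=> _ [n _ <-]].
have f_noninc x y : x <= y -> f y <= f x.
  move=> xy; apply: f_le => n; apply: le_trans (k_le_f x n).
  by apply: ler_wpM2l => //; apply: w_noninc; rewrite lerD2r.
have f_lip x y : f x <= f y + B * `|x - y|.
  apply: f_le => n; have := k_le_f y n; rewrite -(lerD2r (B * `|x - y|)).
  apply: le_trans; rewrite /k.
  have := ler_wpM2l (s0 n) (w_lip (x - n%:R) (y - n%:R)).
  have -> : x - n%:R - (y - n%:R) = x - y by ring.
  move=> /le_trans -> //; rewrite mulrDr lerD2l.
  by apply: ler_wpM2r.
have f_small e : 0 < e -> exists M : R, forall x, M <= x -> f x <= e.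
  move=> e0.
  have [N _ sN] := (cvgrPdist_le _ _).1 scvg e e0.
  exists (N%:R + B / e) => x Mx; apply: f_le => n.
  have Be : 0 < B / e by exact: divr_gt0.
  have [Nn|nN] := leqP N n.
    have := sN n Nn; rewrite sub0r normrN ger0_norm//; apply: le_trans.
    by rewrite ler_piMr// invf_le1// lerDl le_max lexx.
  have nNR : n%:R <= N%:R :> R by rewrite ler_nat ltnW.
  apply: le_trans (ler_wpM2r (ltW (w0 _)) (sB n)) _.
  rewrite ler_pdivrMr// -ler_pdivrMl// mulrC.
  apply: (@le_trans _ _ (x - n%:R)); first lra.
  by rewrite (@le_trans _ _ (Num.max 0 (x - n%:R)))// ?lerDr// le_max lexx orbT.
have f0 x : 0 <= f x.
  by apply: le_trans (k_le_f x 0%N); rewrite mulr_ge0// ltW.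
exists (fun x => f x + w x); last first.
  move=> n; apply: (@le_trans _ _ (f n%:R)); last by rewrite lerDl ltW.
  by have := k_le_f n%:R n; rewrite /k subrr /w maxxx addr0 invr1 mulr1.
split.
- apply: continuous_subspaceT => x.
  apply: (@one_sided_lipschitz_continuous (B + 1)) => y z.
  have := f_lip y z; have := w_lip y z; rewrite mulrDl mul1r; lra.
- move=> x y; rewrite !in_itv/= !andbT => x0 y0 xy.
  apply: ler_ltD; first exact/f_noninc/ltW.
  rewrite /w ltf_pV2 ?posrE// ltrD2l /Num.max.
  by case: ifPn; case: ifPn; lra.
apply/cvgrPdist_le => e e0.
have [M fM] := f_small (e / 2) ltac:(lra).
near=> x.
have fx : f x <= e / 2.
  by apply: fM; near: x; apply: nbhs_pinfty_ge; rewrite num_real.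
have wx : w x <= e / 2.
  rewrite -[e / 2]invrK /w lef_pV2 ?posrE// ?invr_gt0; last lra.
  apply: (@le_trans _ _ x).
    by near: x; apply: nbhs_pinfty_ge; rewrite num_real.
  by rewrite (@le_trans _ _ (Num.max 0 x))// ?lerDr// le_max lexx orbT.
rewrite sub0r normrN ger0_norm ?addr_ge0// ?(ltW (w0 _))//; lra.
Unshelve. all: by end_near. Qed.

(** The form in which telescoping estimates of the averages arrive: boundary
    terms bounded by c are divided by the number n of summands. *)
Lemma limn_esup_between (u : nat -> \bar R) (lo hi c : R) :
  (forall n, (0 < n)%N ->
    ((lo - c / n%:R)%:E <= u n <= (hi + c / n%:R)%:E)%E) ->
  (lo%:E <= limn_esup u <= hi%:E)%E.
Proof.
move=> u_between.
have c_small e : 0 < e -> \forall n \near \oo, (0 < n)%N /\ c / n%:R <= e.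
  move=> e0; near=> n.
  have n0 : (0 < n)%N by near: n; exact: nbhs_infty_gt.
  split => //; rewrite ler_pdivrMr ?ltr0n// mulrC -ler_pdivrMr//.
  by near: n; exact: nbhs_infty_ger.
apply/andP; split; apply/lee_addgt0Pr => e e0; have := c_small e e0.
- move=> small; rewrite -leeBlDr//; apply: le_ereal_inf_tmp => _ [A Aoo <-].
  have [n [[n0 cn] An]] := filter_ex (filterI small Aoo).
  have /andP[un _] := u_between n n0.
  apply: (@le_trans _ _ (u n)); last by apply: ereal_sup_ubound; exists n.
  by apply: le_trans un; rewrite -EFinB lee_fin; lra.
- move=> small; apply: ge_ereal_inf.
  exists (ereal_sup (u @` [set n | (0 < n)%N /\ c / n%:R <= e])).
    by eexists; [exact: small|].
  apply: ge_ereal_sup => _ [n [n0 cn] <-].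
  have /andP[_] := u_between n n0; move/le_trans; apply.
  by rewrite -EFinD lee_fin; lra.
Unshelve. all: by end_near. Qed.

(** If every index in [1, M] were expensive for one of the two sequences, then
    x + y would exceed 12 C / N on M >= N / 6 indices, and the two sums together
    would exceed 2 C. *)
Lemma pigeonhole_sum2 (N M : nat) (x y : nat -> R) (C : R) :
  (M < N)%N -> (N <= 6 * M)%N -> 0 < C ->
  (forall k, (k < N)%N -> 0 <= x k) -> (forall k, (k < N)%N -> 0 <= y k) ->
  \sum_(k < N) x k <= C -> \sum_(k < N) y k <= C ->
  exists m, [/\ (0 < m <= M)%N, x m <= C / (N%:R / 12) &
    y m <= C / (N%:R / 12)].
Proof.
move=> MN NM C0 x0 y0 xC yC; apply: contrapT => noM.
have N0 : 0 < N%:R :> R by rewrite ltr0n (leq_ltn_trans _ MN).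
have large m : (0 < m <= M)%N -> C / (N%:R / 12) < x m + y m.
  move=> mM; rewrite ltNge; apply/negP => xy; apply: noM; exists m.
  have mN : (m < N)%N by apply: leq_ltn_trans MN; case/andP: mM.
  by split=> //; apply: le_trans xy; rewrite ?lerDl ?lerDr ?x0 ?y0.
have : \sum_(k < N) (x k + y k) <= C + C by rewrite big_split/= lerD.
apply/negP; rewrite -ltNge.
rewrite -(big_mkord xpredT (fun k => x k + y k)).
rewrite (big_cat_nat (n := 1))//=; last exact: leq_ltn_trans MN.
rewrite (big_cat_nat (n := M.+1) (m := 1%N))//=.
have ge0 m n : (n <= N)%N -> 0 <= \sum_(m <= k < n) (x k + y k).
  move=> nN; rewrite big_nat_cond; apply: sumr_ge0 => k /andP[/andP[_ kn] _].
  by have kN := leq_trans kn nN; rewrite addr_ge0 ?x0 ?y0.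
rewrite ltr_wpDl ?(ge0 0%N 1%N (leq_ltn_trans (leq0n M) MN))//.
rewrite ltr_wpDr ?ge0//.
have M0 : (0 < M)%N.
  by move: N0; rewrite ltr0n; move: NM; clear; case: M => //; case: N.
apply: (@le_lt_trans _ _ (\sum_(1 <= k < M.+1) (C / (N%:R / 12)))); last first.
  by apply: ltr_sum_nat => // m mM; exact: large.
rewrite sumr_const_nat subn1/= -mulr2n -[leLHS]mulr_natl -[leRHS]mulr_natl.
rewrite [2 * C]mulrC mulrCA ler_pM2l// -(ler_pM2r N0).
have : N%:R <= (6 * M)%:R :> R by rewrite ler_nat.
rewrite natrM.
have -> : M%:R * (N%:R / 12)^-1 * N%:R = 12 * M%:R :> R by field; lra.
lra.
Qed.

Lemma sume_finE (N : nat) (x : nat -> \bar R) (C : R) :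
  (forall k, (k < N)%N -> 0 <= x k)%E -> (\sum_(k < N) x k <= C%:E)%E ->
  (forall k, (k < N)%N -> (fine (x k))%:E = x k) /\
  \sum_(k < N) fine (x k) <= C.
Proof.
move=> x0 xC.
have finx k : (k < N)%N -> (fine (x k))%:E = x k.
  move=> kN; apply: fineK; rewrite ge0_fin_numE ?x0//.
  apply: le_lt_trans (ltry C); apply: le_trans xC.
  by rewrite (bigD1 (Ordinal kN))//= leeDl// sume_ge0// => i _; exact: x0.
split => //; rewrite -lee_fin; apply: le_trans xC.
by rewrite -sumEFin; apply: lee_sum => k _; rewrite finx.
Qed.

Lemma pigeonhole_sume2 (N M : nat) (x y : nat -> \bar R) (C : R) :
  (M < N)%N -> (N <= 6 * M)%N -> 0 < C ->
  (forall k, (k < N)%N -> 0 <= x k)%E -> (forall k, (k < N)%N -> 0 <= y k)%E ->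
  (\sum_(k < N) x k <= C%:E)%E -> (\sum_(k < N) y k <= C%:E)%E ->
  exists m, [/\ (0 < m <= M)%N, (x m <= (C / (N%:R / 12))%:E)%E &
    (y m <= (C / (N%:R / 12))%:E)%E].
Proof.
move=> MN NM C0 x0 y0 xC yC.
have [xfin sx] := sume_finE x0 xC; have [yfin sy] := sume_finE y0 yC.
have x0' k : (k < N)%N -> 0 <= fine (x k) by move=> kN; exact/fine_ge0/x0.
have y0' k : (k < N)%N -> 0 <= fine (y k) by move=> kN; exact/fine_ge0/y0.
have [m [/andP[m0 mM] xm ym]] := pigeonhole_sum2 MN NM C0 x0' y0' sx sy.
have mN := leq_ltn_trans mM MN.
by exists m; rewrite m0 mM -xfin// -yfin// !lee_fin.
Qed.

(** A finite bound on the distance forces both values to be finite, since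
    oo - oo is infinite in the extended reals. *)
Lemma abse_sub_le_fin (x y : \bar R) (c : R) : (`|x - y| <= c%:E)%E ->
  exists x' y' : R, [/\ x = x'%:E, y = y'%:E & `|x' - y'| <= c].
Proof.
by case: x y => [x| |] [y| |]//=; rewrite lee_fin => h; exists x, y.
Qed.

End comparison_function_theory.

(** * Measurability on separable spaces *)

Section measurability_of_the_dynamics.
Context {R : realType} {dO : measure_display} {Om : measurableType dO}.

Lemma countable_bigcup_measurable (I : choiceType) (D : set I)
    (F : I -> set Om) :
  countable D -> (forall i, D i -> measurable (F i)) ->
  measurable (\bigcup_(i in D) F i).
Proof.
move=> /countable_injP[f f_inj] mF; rewrite bigcup_set_type.
apply: countable_bigcupT_measurable; last first.
  by move=> i; apply: mF; exact: set_valP.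
apply/countable_injP; exists (f \o val) => i j _ _ /= fij.
by apply/val_inj/f_inj => //; exact: valP.
Qed.

Lemma separable_prod (T1 T2 : normedModType R) :
  separable T1 -> separable T2 -> separable (T1 * T2)%type.
Proof.
move=> [D1 cD1 dD1] [D2 cD2 dD2]; exists (D1 `*` D2); first exact: countableX.
move=> O [[x y] Oxy] oO.
have [/= e e0 eO] := (nbhs_ballP _ _).1 (open_nbhs_nbhs (conj oO Oxy)).
have [a [xa D1a]] : ball x (e : R) `&` D1 !=set0.
  by apply: dD1; [exists x; exact: ballxx|exact: ball_open].
have [b [yb D2b]] : ball y (e : R) `&` D2 !=set0.
  by apply: dD2; [exists y; exact: ballxx|exact: ball_open].
by exists (a, b); split => //; exact: eO.
Qed.

Lemma RV_measurable_open (T : normedModType R) (X : Om -> T) (B : set T) :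
  RV X -> open B -> measurable (X @^-1` B).
Proof.
move=> mX oB; rewrite -[_ @^-1` _]setTI; apply: (mX measurableT B).
exact: sub_sigma_algebra.
Qed.

Lemma RV_open (T : normedModType R) (X : Om -> T) :
  (forall B, open B -> measurable (X @^-1` B)) -> RV X.
Proof.
move=> mX; rewrite /RV/=.
apply: (@measurability _ _ _ (borel T) setT X (@open T)) => //.
by move=> _ [B oB <-]; rewrite setTI; exact: mX.
Qed.

Lemma RV_comp (T T' : normedModType R) (h : T -> T') (X : Om -> T) :
  continuous h -> RV X -> RV (h \o X).
Proof.
move=> h_cont mX; apply: RV_open => B oB.
rewrite comp_preimage; apply: RV_measurable_open => //.
by apply: open_comp => // x _; exact: h_cont.
Qed.

(** Joint measurability is where separability enters: an open subset of the
    product is a countable union of boxes of balls centred at points of the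
    dense sets, of radii 1 / (n + 1). *)
Lemma RV_pair (T1 T2 : normedModType R) (X : Om -> T1) (Y : Om -> T2) :
  separable T1 -> separable T2 -> RV X -> RV Y ->
  RV ((fun w => (X w, Y w)) : Om -> (T1 * T2)%type).
Proof.
move=> [D1 cD1 dD1] [D2 cD2 dD2] mX mY; apply: RV_open => B oB.
pose box (i : T1 * T2 * nat) : set (T1 * T2) :=
  ball i.1.1 (i.2.+1%:R^-1 : R) `*` ball i.1.2 (i.2.+1%:R^-1 : R).
pose I := (D1 `*` D2 `*` setT) `&` [set i | box i `<=` B].
have -> : (fun w => (X w, Y w)) @^-1` B =
    \bigcup_(i in I) ((X @^-1` ball i.1.1 (i.2.+1%:R^-1 : R)) `&`
                      (Y @^-1` ball i.1.2 (i.2.+1%:R^-1 : R))).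
  apply/seteqP; split => [w /= Bw|w [i [_ iB] [Xi Yi]]]; last exact: iB.
  have [/= e e0 eB] := (nbhs_ballP _ _).1 (open_nbhs_nbhs (conj oB Bw)).
  have [n ne] : exists n : nat, n.+1%:R^-1 < e / 2 :> R.
    have e2 : 0 < e / 2 by rewrite divr_gt0.
    by have [n ne] := filter_ex (near_infty_natSinv_lt (PosNum e2)); exists n.
  have n0 : 0 < n.+1%:R^-1 :> R by rewrite invr_gt0.
  have [a [Xa D1a]] : ball (X w) (n.+1%:R^-1 : R) `&` D1 !=set0.
    by apply: dD1; [exists (X w); exact: ballxx|exact: ball_open].
  have [b [Yb D2b]] : ball (Y w) (n.+1%:R^-1 : R) `&` D2 !=set0.
    by apply: dD2; [exists (Y w); exact: ballxx|exact: ball_open].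
  exists (a, b, n); last by split; exact: ball_sym.
  split => //= -[u v] [/= au bv]; apply: eB; split => /=.
    rewrite [e]splitr; apply: (ball_triangle (y := a)).
      by apply: le_ball Xa; exact: ltW.
    by apply: le_ball au; exact: ltW.
  rewrite [e]splitr; apply: (ball_triangle (y := b)).
    by apply: le_ball Yb; exact: ltW.
  by apply: le_ball bv; exact: ltW.
apply: countable_bigcup_measurable => [|i _].
  apply: sub_countable (countableX (countableX cD1 cD2) (countableP setT)).
  by apply: subset_card_le => i [].
by apply: measurableI; apply: RV_measurable_open => //; exact: ball_open.
Qed.

End measurability_of_the_dynamics.

(** * Trajectories, splicing of controls and dynamic programming *)

Section trajectories_and_costs.
Context {R : realType} {dO : measure_display} {Om : measurableType dO}
  {SX SU SW : completeNormedModType R}.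
Variable S : stoch_ocp Om SX SU SW.

Local Notation state := (Om -> SX).
Local Notation control := (Om -> SU).

Lemma traj_add j X (U : nat -> control) m k :
  traj S j X U (m + k) =
  traj S (j + m) (traj S j X U m) (fun i => U (m + i)%N) k.
Proof.
by elim: k => [|k IH]; rewrite ?addn0// addnS/= IH addnA.
Qed.

Lemma eq_traj j X (U U' : nat -> control) m :
  (forall k, (k < m)%N -> U k = U' k) -> traj S j X U m = traj S j X U' m.
Proof.
elim: m => [//|m IH] UU'/=.
by rewrite IH ?UU'// => k km; apply: UU'; rewrite ltnW.
Qed.

Definition splice m (U U' : nat -> control) : nat -> control :=
  fun k => if (k < m)%N then U k else U' (k - m)%N.

Lemma splice_head m U U' k : (k < m)%N -> splice m U U' k = U k.
Proof. by rewrite /splice => ->. Qed.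

Lemma splice_tail m U U' : (fun i => splice m U U' (m + i)%N) = U'.
Proof. by apply/funext => i; rewrite /splice ltnNge leq_addr/= addKn. Qed.

Lemma traj_splice_head j X m U U' k : (k <= m)%N ->
  traj S j X (splice m U U') k = traj S j X U k.
Proof.
by move=> km; apply: eq_traj => i ik; rewrite splice_head// (leq_trans ik).
Qed.

Lemma Uads_head m n j X U : Uads S `I_(m + n) j X U -> Uads S `I_m j X U.
Proof. by move=> adU k /= km; apply: adU; rewrite /= ltn_addr. Qed.

Lemma Uads_tail m n j X U : Uads S `I_(m + n) j X U ->
  Uads S `I_n (j + m) (traj S j X U m) (fun i => U (m + i)%N).
Proof.
by move=> adU k /= kn; rewrite -traj_add; apply: adU; rewrite /= ltn_add2l.
Qed.

Lemma Uads_splice (K : set nat) m j X U U' : Uads S `I_m j X U ->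
  Uads S K (j + m) (traj S j X U m) U' ->
  Uads S [set k | (k < m)%N \/ K (k - m)%N] j X (splice m U U').
Proof.
move=> adU adU' k /= kK; have [km|mk] := ltnP k m.
  by rewrite splice_head// traj_splice_head ?(ltnW km)//; exact: adU.
case: kK => [|Kkm]; first by rewrite ltnNge mk.
have -> : traj S j X (splice m U U') k =
    traj S (j + m) (traj S j X U m) U' (k - m).
  by rewrite -{1}(subnKC mk) traj_add traj_splice_head// splice_tail.
by rewrite /splice ltnNge mk; exact: adU'.
Qed.

(** Admissible controls do not leave the class of states that do not anticipate
    the noise: an admissible sequence from the successor, preceded by U, is
    admissible from X, so the independence required at the successor is an
    instance of the independence known at X. *)
Lemma states_step j X U : standing S -> states S j X -> Uad S X U ->
  states S j.+1 (step S j X U).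
Proof.
move=> [[sepX sepU sepW] dyn_cont _ _ [mW _ _]] [mX indX] adU; split.
  apply: (RV_comp (h := dyn S) (X := fun w => (X w, U w, noise S j w))) => //.
  apply: RV_pair => //; first exact: separable_prod.
  by apply: RV_pair => //; case: adU.
move=> U' adU' k.
pose U1 := splice 1 (fun=> U) U'.
have adU1 : Uads S setT j X U1.
  have ad1 : Uads S `I_1 j X (fun=> U) by case.
  have := @Uads_splice setT 1 j X (fun=> U) U' ad1.
  by rewrite addn1/= addn0 => /(_ adU') ad i _; apply: ad; right.
have := indX U1 adU1 k.+1.
have -> : traj S j X U1 k.+1 = traj S j.+1 (step S j X U) U' k.
  by rewrite -add1n traj_add traj_splice_head//= splice_tail addn0 addn1.
by rewrite addSnnS /U1 /splice ltnS ltn0 subn1.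
Qed.

Lemma states_traj N j X U : standing S -> states S j X ->
  Uads S `I_N j X U -> forall k, (k <= N)%N ->
  states S (j + k) (traj S j X U k).
Proof.
move=> std sX adU; elim=> [|k IH] kN; first by rewrite addn0.
by rewrite addnS; apply: states_step => //; [exact/IH/ltnW|exact: adU].
Qed.

(** The original and the modified problem are the instances of one family of
    problems with time-varying stage cost c. *)
Definition total_cost (c : nat -> state -> control -> \bar R) (N j : nat)
    (X : state) (U : nat -> control) : \bar R :=
  (\sum_(k < N) c (j + k)%N (traj S j X U k) (U k))%E.

Definition opt_value (c : nat -> state -> control -> \bar R) (N j : nat)
    (X : state) : \bar R :=
  ereal_inf [set total_cost c N j X U | U in Uads S `I_N j X].

Lemma total_cost_add c m n j X U :
  (total_cost c (m + n) j X U = total_cost c m j X U +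
    total_cost c n (j + m) (traj S j X U m) (fun i => U (m + i)%N))%E.
Proof.
rewrite /total_cost big_split_ord/=; congr (_ + _)%E.
by apply: eq_bigr => k _; rewrite traj_add addnA.
Qed.

Lemma opt_value_le_total_cost c N j X U : Uads S `I_N j X U ->
  (opt_value c N j X <= total_cost c N j X U)%E.
Proof. by move=> adU; apply: ereal_inf_lbound; exists U. Qed.

(** Dynamic programming, in the direction that does not require a minimizer:
    any admissible continuation can be spliced to U at time m. *)
Lemma opt_value_add c m n j X U : Uads S `I_m j X U ->
  total_cost c m j X U \is a fin_num ->
  (opt_value c (m + n) j X <=
   total_cost c m j X U + opt_value c n (j + m) (traj S j X U m))%E.
Proof.
move=> adU finU; rewrite -leeBlDl//; apply: le_ereal_inf_tmp => _ [U' adU' <-].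
rewrite leeBlDl//.
have := @opt_value_le_total_cost c (m + n) j X (splice m U U').
rewrite total_cost_add traj_splice_head// splice_tail.
have -> : total_cost c m j X (splice m U U') = total_cost c m j X U.
  apply: eq_bigr => k _; have km := ltn_ord k.
  by rewrite traj_splice_head ?(ltnW km)// splice_head.
apply => k /= kmn; apply: (Uads_splice adU adU').
have [|mk] := ltnP k m; first by left.
by right; rewrite /= ltn_subLR.
Qed.

End trajectories_and_costs.

(** * The modified problem under strict dissipativity *)

Section dissipative_problem.
Context {R : realType} {dO : measure_display} {Om : measurableType dO}
  {SX SU SW : completeNormedModType R}.
Variable S : stoch_ocp Om SX SU SW.
Hypothesis standingS : standing S.
Variable d : (Om -> SX) -> (Om -> SX) -> \bar R.
Hypothesis d_pm : pseudometric_on (@RV R dO Om SX) d.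
Variables (Xs : nat -> Om -> SX) (Us : nat -> Om -> SU).
Hypothesis stat_pair : stationary_pair S Xs Us.
Hypothesis stat_fin : stat_cost S Xs Us \is a fin_num.
Variables (lam : nat -> (Om -> SX) -> R) (alpha : R -> R) (Cl : R).
Hypothesis diss : strictly_dissipative S Xs Us d lam Cl alpha.
Hypothesis mod_cost_Xs :
  forall j, mod_cost S Xs Us lam j (Xs j) (Us j) = 0%E.

Local Notation state := (Om -> SX).
Local Notation control := (Om -> SU).
Local Notation s := (fine (stat_cost S Xs Us)).
Local Notation mcost := (mod_cost S Xs Us lam).
Local Notation mJ := (mod_J S Xs Us lam).
Local Notation mV := (mod_V S Xs Us lam).
Local Notation nearXs := (Bbar S Xs d).

Lemma stat_costE : stat_cost S Xs Us = s%:E.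
Proof. by rewrite fineK. Qed.

Lemma traj_Xs j k : traj S j (Xs j) (fun i => Us (j + i)%N) k = Xs (j + k).
Proof.
elim: k => [|k IH]; first by rewrite addn0.
by rewrite addnS/= IH; case: stat_pair => _ ->.
Qed.

Lemma Uads_Xs K j : Uads S K j (Xs j) (fun i => Us (j + i)%N).
Proof.
move=> k _; rewrite traj_Xs; case: stat_pair => _ _ adU _.
by have := adU (j + k)%N I; rewrite -[X in Uad _ X]/(traj S 0 (Xs 0) Us _)
  -[traj S 0 (Xs 0) Us _]/(traj S 0 (Xs 0) (fun i => Us (0 + i)%N) _) traj_Xs.
Qed.

Lemma states_Xs j : states S j (Xs j).
Proof.
have [sX0 _ _ _] := stat_pair.
have := states_traj standingS sX0 (@Uads_Xs `I_j 0) (leqnn j).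
by rewrite traj_Xs.
Qed.

Lemma dist_ge0 j X : states S j X -> (0 <= d X (Xs j))%E.
Proof. by move=> [mX _]; apply: (pm_ge0 d_pm) => //; case: (states_Xs j). Qed.

Lemma near_dist rho j X : nearXs rho j X ->
  exists x, [/\ d X (Xs j) = x%:E, 0 <= x & x <= rho].
Proof.
move=> [sX]; have := dist_ge0 sX.
by case: (d X (Xs j)) => [x| |]//=; rewrite !lee_fin; exists x.
Qed.

Lemma near_mono rho rho' j X : rho <= rho' -> nearXs rho j X -> nearXs rho' j X.
Proof.
by move=> rr' [sX dX]; split => //; apply: le_trans dX _; rewrite lee_fin.
Qed.

Lemma alphaK : classK alpha. Proof. by case: diss => -[]. Qed.

Lemma alpha_dist_ge0 j X : states S j X -> (0 <= cmp_ext alpha (d X (Xs j)))%E.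
Proof.
move=> sX; have := dist_ge0 sX.
case: (d X (Xs j)) => [x| |]//=; rewrite !lee_fin; exact/classK_ge0/alphaK.
Qed.

Lemma near_of_alpha rho j X : states S j X -> 0 <= rho ->
  (cmp_ext alpha (d X (Xs j)) <= (alpha rho)%:E)%E -> nearXs rho j X.
Proof.
move=> sX rho0 ad; split => //; move: ad; have := dist_ge0 sX.
case: (d X (Xs j)) => [x| |]//=; rewrite !lee_fin => x0.
by rewrite classK_ler//; exact: alphaK.
Qed.

Lemma alpha_le_mod_cost j X U : states S j X -> Uad S X U ->
  (cmp_ext alpha (d X (Xs j)) <= mcost j X U)%E.
Proof. by case: diss => _ _; apply. Qed.

Lemma mod_cost_ge0 j X U : states S j X -> Uad S X U -> (0 <= mcost j X U)%E.
Proof.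
move=> sX adU; apply: le_trans (alpha_le_mod_cost sX adU).
exact: alpha_dist_ge0.
Qed.

Lemma mod_cost_traj_ge0 N j X U k : states S j X -> Uads S `I_N j X U ->
  (k < N)%N -> (0 <= mcost (j + k) (traj S j X U k) (U k))%E.
Proof.
move=> sX adU kN; apply: mod_cost_ge0; last exact: adU.
exact: states_traj (ltnW kN).
Qed.

Lemma mod_J_ge0 N j X U : states S j X -> Uads S `I_N j X U ->
  (0 <= mJ N j X U)%E.
Proof.
by move=> sX adU; apply: sume_ge0 => k _; exact: mod_cost_traj_ge0 adU _.
Qed.

Lemma mod_J_add m n j X U : (mJ (m + n) j X U =
  mJ m j X U + mJ n (j + m) (traj S j X U m) (fun i => U (m + i)%N))%E.
Proof. exact: total_cost_add. Qed.

Lemma mod_J_le m n j X U : states S j X -> Uads S `I_(m + n) j X U ->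
  (mJ m j X U <= mJ (m + n) j X U)%E.
Proof.
move=> sX adU; rewrite mod_J_add leeDl//; apply: mod_J_ge0.
  by apply: (states_traj standingS sX adU); rewrite leq_addr.
exact: Uads_tail.
Qed.

Lemma mod_V_le N j X U : Uads S `I_N j X U -> (mV N j X <= mJ N j X U)%E.
Proof. exact: opt_value_le_total_cost. Qed.

Lemma mod_V_ge0 N j X : states S j X -> (0 <= mV N j X)%E.
Proof.
by move=> sX; apply: le_ereal_inf_tmp => _ [U adU <-]; exact: mod_J_ge0.
Qed.

(** The first stage cost alone already costs at least alpha of the distance. *)
Lemma alpha_le_mod_V N j X : (0 < N)%N -> states S j X ->
  (cmp_ext alpha (d X (Xs j)) <= mV N j X)%E.
Proof.
move=> N0 sX; apply: le_ereal_inf_tmp => _ [U adU <-].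
have adU0 : Uad S X (U 0%N) by exact: adU.
apply: le_trans (alpha_le_mod_cost sX adU0) _.
case: N N0 adU => // N _ adU.
have := @mod_J_le 1 N j X U sX adU.
by rewrite {1}/mod_J big_ord_recl big_ord0/= adde0 addn0.
Qed.

Lemma mod_V_Xs N j : mV N j (Xs j) = 0%E.
Proof.
apply/eqP; rewrite eq_le mod_V_ge0 ?andbT; last exact: states_Xs.
apply: le_trans (mod_V_le (@Uads_Xs _ _)) _.
by rewrite /mod_J big1// => k _; rewrite traj_Xs mod_cost_Xs.
Qed.

(** The storage terms telescope. The costs may be infinite: only real numbers
    change places. *)
Lemma mod_J_rotated N j X U : (mJ N j X U =
  J S N j X U + (lam j X - lam (j + N)%N (traj S j X U N) - N%:R * s)%:E)%E.
Proof.
elim: N => [|N IH].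
  by rewrite /mod_J /J !big_ord0 addn0 subrr mul0r subrr adde0.
have mE M : mJ M j X U =
    (\sum_(k < M) mcost (j + k) (traj S j X U k) (U k))%E by [].
have -> : mJ N.+1 j X U =
    (mJ N j X U + mcost (j + N)%N (traj S j X U N) (U N))%E.
  by rewrite !mE big_ord_recr.
rewrite IH /J big_ord_recr/= -/(J S N j X U) /mod_cost stat_costE.
rewrite addnS; move: (J S N j X U) (cost S _ _) => x y.
rewrite -natr1 mulrDl mul1r.
by case: x y => [x| |] [y| |]//=; rewrite -!EFinD; congr EFin; ring.
Qed.

(** Cheap reachability bounds the modified cost of an optimal sequence uniformly
    in the horizon; this is the source of the turnpike property. *)
Lemma mod_J_optimal_le (r Clam CV : R) N j X U :
  (forall j X, nearXs r j X -> `|lam j X| <= Clam) ->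
  cheaply_reachable S Xs Us d r CV -> (0 < N)%N -> nearXs r j X ->
  Uads S `I_N j X U -> J S N j X U = V S N j X ->
  (mJ N j X U <= (Clam + Cl + CV)%:E)%E.
Proof.
move=> lam_bound cheap N0 nX adU optU; have [sX _] := nX.
have [_ lam_low _] := diss.
have := lam_low _ _ (states_traj standingS sX adU (leqnn N)).
have := lam_bound _ _ nX; rewrite ler_norml => /andP[_ lamX] lamN.
have := cheap _ _ _ N0 nX; rewrite stat_costE -EFinM leeBlDr// -EFinD => VN.
rewrite mod_J_rotated optU; apply: le_trans (leeD2r _ VN) _.
by rewrite -EFinD lee_fin; lra.
Qed.

Lemma first_half_split m N : (m < N./2)%N ->
  exists n, [/\ (0 < n)%N, N = (m.+1 + n)%N & (N <= n * 2)%N].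
Proof. by move=> mN; exists (N - m.+1)%N; split; lia. Qed.

(** Turnpike property for two sequences at once: both must be cheap, hence close
    to the stationary process, at one common time in the first half of the
    horizon. *)
Lemma common_near_time (rho C : R) N j X U U' : (2 <= N)%N -> 0 < C ->
  0 <= rho -> alpha rho = C / (N%:R / 12) -> states S j X ->
  Uads S `I_N j X U -> Uads S `I_N j X U' ->
  (mJ N j X U <= C%:E)%E -> (mJ N j X U' <= C%:E)%E ->
  exists m, [/\ (0 < m <= N./2)%N, nearXs rho (j + m)%N (traj S j X U m) &
    nearXs rho (j + m)%N (traj S j X U' m)].
Proof.
move=> N2 C0 rho0 arho sX adU adU' UC U'C.
have [m [mN xm ym]] := @pigeonhole_sume2 R N N./2 _ _ C ltac:(lia) ltac:(lia) C0
  (fun k => mod_cost_traj_ge0 sX adU (k := k))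
  (fun k => mod_cost_traj_ge0 sX adU' (k := k)) UC U'C.
have mltN : (m < N)%N by lia.
have cheap_near W : Uads S `I_N j X W ->
    (mcost (j + m) (traj S j X W m) (W m) <= (C / (N%:R / 12))%:E)%E ->
    nearXs rho (j + m) (traj S j X W m).
  move=> adW Wm.
  have sW := states_traj standingS sX adW (ltnW mltN).
  apply: near_of_alpha => //; rewrite arho.
  by apply: le_trans Wm; apply: alpha_le_mod_cost => //; exact: adW.
by exists m; split => //; exact: cheap_near.
Qed.

(** Up to a time m at which both trajectories are close to the stationary one, a
    sequence U optimal for J is nearly as cheap in modified cost as U': the two
    remaining optimal values differ from V n (j + m) (Xs (j + m)) by at most g
    each, so that term cancels, and the storage terms at time m differ from
    lam (j + m) (Xs (j + m)) by at most l each. *)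
Lemma optimal_prefix (g l : R) m n j X U U' :
  Uads S `I_(m + n) j X U -> J S (m + n) j X U = V S (m + n) j X ->
  Uads S `I_(m + n) j X U' -> mJ m j X U' \is a fin_num ->
  let dev (Y : state) :=
    (`|V S n (j + m) Y - V S n (j + m) (Xs (j + m))| <= g%:E)%E /\
    `|lam (j + m) Y - lam (j + m) (Xs (j + m))| <= l in
  dev (traj S j X U m) -> dev (traj S j X U' m) ->
  (mJ m j X U <= mJ m j X U' + (2 * g + 2 * l)%:E)%E.
Proof.
move=> adU optU adU' finU' dev [Vm lm] [Vm' lm'].
have [v1 [v0 [v1E v0E v01]]] := abse_sub_le_fin Vm.
have [v2 [v0' [v2E]]] := abse_sub_le_fin Vm'.
rewrite v0E => -[<-] v02 {v0' Vm Vm'}.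
have JmE W : J S m j X W = (mJ m j X W -
    (lam j X - lam (j + m)%N (traj S j X W m) - m%:R * s)%:E)%E.
  by rewrite mod_J_rotated addeK.
have finJ : J S m j X U' \is a fin_num by rewrite JmE fin_numB finU'.
have upper : (V S (m + n) j X <= J S m j X U' + v2%:E)%E.
  rewrite -v2E; apply: (@opt_value_add _ _ _ _ _ _ S (fun=> cost S)) => //.
  exact: Uads_head adU'.
have lower : (J S m j X U + v1%:E <= V S (m + n) j X)%E.
  rewrite -optU -v1E [leRHS](total_cost_add S (fun=> cost S)).
  apply: leeD2l; apply: (@opt_value_le_total_cost _ _ _ _ _ _ S (fun=> cost S)).
  exact: Uads_tail.
have := le_trans lower upper.
rewrite !JmE -(fineK finU').
case: (mJ m j X U) => [x| |]//=; last by move=> _; rewrite leNye.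
rewrite -!EFinD !lee_fin.
move: v01 v02 lm lm'; rewrite !ler_norml.
by move=> /andP[? ?] /andP[? ?] /andP[? ?] /andP[? ?]; lra.
Qed.

(** * One closed-loop step *)

Section one_step.
Variables (r Clam CV eps teps tr : R) (gV : R -> R -> R) (glam gtV : R -> R).
Hypothesis lam_bounded : forall j X, nearXs r j X -> `|lam j X| <= Clam.
Hypothesis cheap : cheaply_reachable S Xs Us d r CV.
Hypothesis V_cont : forall N j X, (0 < N)%N -> nearXs eps j X ->
  (`| V S N j X - V S N j (Xs j) | <= cmp_ext (gV N%:R) (d X (Xs j)))%E.
Hypothesis lam_cont : forall j X, nearXs teps j X ->
  (`| lam j X - lam j (Xs j) |%:E <= cmp_ext glam (d X (Xs j)))%E.
Hypothesis tV_cont : forall N j X, (0 < N)%N -> nearXs tr j X ->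
  (`| mV N j X - mV N j (Xs j) | <= cmp_ext gtV (d X (Xs j)))%E.
Hypotheses (gV_gain : horizon_gain gV) (glamK : classK glam)
  (gtVK : classK gtV).

Lemma mod_V_le_dist N j X rho : (0 < N)%N -> nearXs tr j X -> nearXs rho j X ->
  (mV N j X <= (gtV rho)%:E)%E.
Proof.
move=> N0 trX rhoX; have [x [dx x0 xrho]] := near_dist rhoX.
have := tV_cont N0 trX; rewrite mod_V_Xs sube0 dx/= => /(le_trans (lee_abs _)).
move/le_trans; apply; rewrite lee_fin classK_ler//; exact: le_trans xrho.
Qed.

(** M will be half the horizon, which bounds the remaining horizon n from below
    when the common time lies in the first half. *)
Lemma value_deviation (M : R) n j X rho : (0 < n)%N -> 0 <= M <= n%:R ->
  rho <= eps -> nearXs rho j X ->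
  (`|V S n j X - V S n j (Xs j)| <= (gV M rho)%:E)%E.
Proof.
move=> n0 /andP[M0 Mn] rhoeps rhoX; have [x [dx x0 xrho]] := near_dist rhoX.
apply: le_trans (V_cont n0 (near_mono rhoeps rhoX)) _.
rewrite dx lee_fin; have [_ _ gV_dec gV_inc] := gV_gain.
have rho0 := le_trans x0 xrho.
apply: (@le_trans _ _ (gV n%:R rho)).
  by apply: gV_inc; rewrite ?in_itv/= ?andbT.
by apply: gV_dec; rewrite ?in_itv/= ?andbT.
Qed.

Lemma lam_deviation j X rho : rho <= teps -> nearXs rho j X ->
  `|lam j X - lam j (Xs j)| <= glam rho.
Proof.
move=> rhoteps rhoX; have [x [dx x0 xrho]] := near_dist rhoX.
have := lam_cont (near_mono rhoteps rhoX); rewrite dx lee_fin => /le_trans.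
by apply; rewrite classK_ler//; exact: le_trans xrho.
Qed.

(** The heart of the proof. The sequence U is optimal for J, and U' is optimal
    for the modified cost up to gtV rho. At a common time m + 1 where both
    trajectories are rho-close to the stationary one, [optimal_prefix] bounds
    the modified cost of the prefix of U by that of U', hence by mod_V. The
    same prefix without its first step, followed by a good continuation of
    modified cost at most gtV rho, competes in the problem of horizon N that
    starts at the successor. *)
Lemma mod_V_decrease (rho : R) N j X U :
  (2 <= N)%N -> 0 < rho -> rho <= eps -> rho <= teps -> rho <= tr ->
  0 < Clam + Cl + CV ->
  alpha rho = (Clam + Cl + CV) / (N%:R / 12) ->
  nearXs r j X -> Uads S `I_N j X U -> J S N j X U = V S N j X ->
  (mV N j.+1 (step S j X (U 0%N)) + mcost j X (U 0%N) <=
   mV N j X + (2 * gtV rho + 2 * glam rho + 2 * gV (N%:R / 2) rho)%:E)%E.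
Proof.
set C := Clam + Cl + CV => N2 rho0 rhoeps rhoteps rhotr C0 arho nX adU optU.
have N0 : (0 < N)%N by exact: ltnW.
have [sX _] := nX.
have UC : (mJ N j X U <= C%:E)%E.
  exact: (mod_J_optimal_le lam_bounded cheap N0 nX adU optU).
have mV_fin : mV N j X \is a fin_num.
  rewrite ge0_fin_numE ?mod_V_ge0//.
  by apply: le_lt_trans (ltry C); apply: le_trans UC; exact: mod_V_le.
have gtV0 : 0 < gtV rho by exact: classK_gt0.
have [U' [adU' U'C U'V]] : exists U', [/\ Uads S `I_N j X U',
    (mJ N j X U' <= C%:E)%E & (mJ N j X U' <= mV N j X + (gtV rho)%:E)%E].
  (* W is a near-minimizer; if it is dearer than U, then U is one as well *)
  have [_ [W adW <-] WV] := lb_ereal_inf_adherent gtV0 mV_fin.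
  have [WU|UW] := leP (mJ N j X W) (mJ N j X U).
    by exists W; split => //; [exact: le_trans UC|exact: ltW].
  by exists U; split => //; apply: le_trans (ltW UW) (ltW WV).
have [[|m] [/andP[m0 mN] nearU nearU']]//:=
  common_near_time N2 C0 (ltW rho0) arho sX adU adU' UC U'C.
have [n [n0 Nmn Nn]] := first_half_split mN.
have MN : 0 <= (N%:R : R) / 2 <= n%:R.
  apply/andP; split; first by rewrite divr_ge0.
  by rewrite ler_pdivrMr// -natrM ler_nat.
have mU'le : (mJ m.+1 j X U' <= mV N j X + (gtV rho)%:E)%E.
  by apply: le_trans U'V; rewrite Nmn; apply: mod_J_le; rewrite -?Nmn.
have fin_of_le k i Y W z : (0 <= mJ k i Y W)%E -> (mJ k i Y W <= z)%E ->
    z \is a fin_num -> mJ k i Y W \is a fin_num.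
  by move=> ? wz zfin; rewrite ge0_fin_numE// (le_lt_trans wz)// ltey_eq zfin.
have ad_head W : Uads S `I_N j X W -> Uads S `I_m.+1 j X W.
  by rewrite Nmn; exact: Uads_head.
have finU' : mJ m.+1 j X U' \is a fin_num.
  apply: fin_of_le mU'le _; first exact/mod_J_ge0/ad_head.
  by rewrite fin_numD mV_fin.
have := @optimal_prefix (gV (N%:R / 2) rho) (glam rho) m.+1 n j X U U'.
rewrite -Nmn => /(_ adU optU adU' finU').
have dev Y (nearY : nearXs rho (j + m.+1) Y) :=
  conj (value_deviation (M := N%:R / 2) n0 MN rhoeps nearY)
    (lam_deviation rhoteps nearY).
move=> /(_ (dev _ nearU) (dev _ nearU')) mUle.
have finU : mJ m.+1 j X U \is a fin_num.
  by apply: fin_of_le mUle _; [exact/mod_J_ge0/ad_head|rewrite fin_numD finU'].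
pose T i := U (1 + i)%N.
have mUE : (mJ m.+1 j X U =
    mcost j X (U 0%N) + mJ m j.+1 (step S j X (U 0%N)) T)%E.
  rewrite -add1n mod_J_add {1}/mod_J big_ord_recl big_ord0/= adde0 !addn0.
  by rewrite addn1.
have finT : mJ m j.+1 (step S j X (U 0%N)) T \is a fin_num.
  by move: finU; rewrite mUE fin_numD => /andP[].
have adT : Uads S `I_m j.+1 (step S j X (U 0%N)) T.
  have := ad_head _ adU; rewrite -add1n => /Uads_tail.
  by rewrite addn1/= addn0.
have mVle : (mV N j.+1 (step S j X (U 0%N)) <=
    mJ m j.+1 (step S j X (U 0%N)) T + (gtV rho)%:E)%E.
  (* one step was used up, so the continuation has horizon n + 1 *)
  have -> : N = (m + n.+1)%N by rewrite Nmn addSnnS.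
  apply: le_trans (@opt_value_add _ _ _ _ _ _ S mcost _ _ _ _ _ adT finT) _.
  apply: leeD2l; have := traj_add S j X U 1 m.
  rewrite add1n addn1 /= addn0 -/T => <-.
  rewrite addSnnS; apply: mod_V_le_dist => //; exact: near_mono nearU.
rewrite addeC; apply: le_trans (leeD2l _ mVle) _; rewrite addeA -mUE.
apply: le_trans (leeD2r _ mUle) _.
rewrite -addeA -EFinD; apply: le_trans (leeD2r _ mU'le) _.
by rewrite -addeA -EFinD; apply: leeD2l; rewrite lee_fin; lra.
Qed.

End one_step.

(** * Invariance, Lyapunov decrease and averaged cost *)

Section closed_loop.
Variables (gtV : R -> R) (tr r Clam theta0 nuN : R) (N : nat).
Variable kappa : nat -> state -> control.
Hypothesis alphaKoo : classKoo alpha.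
Hypothesis gtVKoo : classKoo gtV.
Hypothesis N_gt0 : (0 < N)%N.
Hypothesis tV_le : forall j X rho, nearXs tr j X -> nearXs rho j X ->
  (mV N j X <= (gtV rho)%:E)%E.
Hypothesis lam_bounded : forall j X, nearXs r j X -> `|lam j X| <= Clam.
Hypothesis near_sublevel : forall j X,
  mod_V_sublevel S Xs Us lam N j theta0 X ->
  nearXs tr j X /\ nearXs r j X.
Hypothesis nuN_ge0 : 0 <= nuN.
Hypothesis decrease : forall j X, mod_V_sublevel S Xs Us lam N j theta0 X ->
  Uad S X (kappa j X) /\
  (mV N j.+1 (step S j X (kappa j X)) + mcost j X (kappa j X) <=
   mV N j X + nuN%:E)%E.

Local Notation sublevel := (mod_V_sublevel S Xs Us lam N).
Local Notation next j X := (step S j X (kappa j X)).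
Local Notation threshold := (gtV (kinv alpha (2 * nuN)) + nuN).

Let gtVK : classK gtV. Proof. by case: gtVKoo. Qed.

(** On the level set theta0 every quantity of the one-step inequality is finite,
    which makes the remaining arguments real linear arithmetic. *)
Lemma closed_loop_step j X : sublevel j theta0 X ->
  exists v v' c x : R,
  [/\ [/\ mV N j X = v%:E, mV N j.+1 (next j X) = v'%:E,
          mcost j X (kappa j X) = c%:E & d X (Xs j) = x%:E],
      [/\ 0 <= v <= theta0, 0 <= v', 0 <= c, 0 <= x & alpha x <= c],
      alpha x <= v <= gtV x, v' + c <= v + nuN & states S j.+1 (next j X)].
Proof.
move=> Yx; have [adU dec] := decrease Yx; have [ntr nr] := near_sublevel Yx.
have [sX mVX] := Yx; have [x [dx x0 _]] := near_dist ntr.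
have sX' := states_step standingS sX adU.
have := mod_V_ge0 N sX'; have := mod_cost_ge0 sX adU.
have := alpha_le_mod_cost sX adU; have := alpha_le_mod_V N_gt0 sX.
have xX : nearXs x j X by split => //; rewrite dx.
have := tV_le ntr xX.
move: mVX dec; rewrite dx/=.
case: (mV N j X) => [v| |]//=; rewrite ?lee_fin ?andbF// => vb.
case: (mV N j.+1 _) => [v'| |]//; case: (mcost _ _ _) => [c| |]//.
rewrite -!EFinD !lee_fin => dec vx xv xc c0 v'0.
by exists v, v', c, x; split => //; rewrite xv.
Qed.

(** Above the threshold the distance x satisfies 2 nuN < alpha x, so
    the decrease alpha x exceeds twice the error nuN; below it, the value is at most
    threshold - nuN and grows by at most nuN. *)
Lemma invariant_sublevel theta j X : threshold <= theta <= theta0 ->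
  sublevel j theta X -> sublevel j.+1 theta (next j X).
Proof.
move=> /andP[theta_ge theta_le] [sX mVX].
have Yx : sublevel j theta0 X.
  split => //; case/andP: mVX => -> /le_trans; apply.
  by rewrite lee_fin.
have [v [v' [c [x [[vE v'E cE dE] [vb v'0 c0 x0 xc] /andP[xv vx] dec sX']]]]] :=
  closed_loop_step Yx.
split => //; rewrite v'E !lee_fin v'0/=.
have := mVX; rewrite vE !lee_fin => /andP[_ vtheta].
have nu2 : 0 <= 2 * nuN by rewrite mulr_ge0.
have [kinv0 akinv] := kinvP alphaKoo nu2.
have [small|large] := leP x (kinv alpha (2 * nuN)).
  move: small; rewrite -(classK_ler gtVK)// => small.
  by have := le_trans vx small; lra.
move: large; rewrite ltNge -(classK_ler alphaK x0 kinv0) akinv -ltNge; lra.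
Qed.

(** Outside the level delta the error nuN is at most half of alpha x, which
    leaves the decrease alpha x / 2. *)
Lemma lyapunov_sublevel delta : threshold <= delta ->
  unif_lyapunov S Xs d kappa
    (fun j => sublevel j theta0 `\` sublevel j delta) (mV N).
Proof.
move=> delta_ge; split.
  move=> j X [[_ /andP[-> mVX]] _].
  exact: le_lt_trans mVX (ltry _).
exists alpha, gtV, (fun x => 2^-1 * alpha x); split => //.
  by apply: classK_scale => //; exact: alphaK.
move=> j X [Yx notQx] _.
have [v [v' [c [x [[vE v'E cE dE] [vb v'0 c0 x0 xc] /andP[xv vx] dec sX']]]]] :=
  closed_loop_step Yx.
rewrite vE v'E dE/= -EFinB !lee_fin xv vx; split => //.
have vdelta : delta < v.
  rewrite ltNge; apply/negP => vdelta; apply: notQx; case: Yx => sX _.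
  by split => //; rewrite vE !lee_fin vdelta andbT; case/andP: vb.
have nu2 : 0 <= 2 * nuN by rewrite mulr_ge0.
have [kinv0 akinv] := kinvP alphaKoo nu2.
have [small|large] := leP x (kinv alpha (2 * nuN)).
  move: small; rewrite -(classK_ler gtVK)// => small.
  by have := le_trans vx small; lra.
move: large; rewrite ltNge -(classK_ler alphaK x0 kinv0) akinv -ltNge; lra.
Qed.

(** Summing the one-step inequality along the closed loop telescopes both mod_V
    and the storage function, which are bounded on the invariant level set. *)
Lemma average_cost X0 : threshold <= theta0 -> sublevel 0 theta0 X0 ->
  (s%:E <= limn_esup (fun K => (K%:R^-1)%:E * Jcl S kappa K X0)
        <= (s + nuN)%:E)%E.
Proof.
move=> thr Y0; pose X j := cl_traj S kappa X0 j.
have YX j : sublevel j theta0 (X j).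
  by elim: j => [//|j IH]; apply: (invariant_sublevel _ IH); rewrite thr/=.
pose c j := fine (mcost j (X j) (kappa j (X j))).
pose v j := fine (mV N j (X j)).
pose l j := lam j (X j).
have lb j : `|l j| <= Clam.
  by apply: lam_bounded; have [] := near_sublevel (YX j).
have stepX j : [/\ cost S (X j) (kappa j (X j)) = (c j + s - l j + l j.+1)%:E,
    0 <= c j, 0 <= v j <= theta0 & v j.+1 + c j <= v j + nuN].
  have [v0 [v' [c0 [x [[vE v'E cE _] [vb v'0 cge0 _ _] _ dec _]]]]] :=
    closed_loop_step (YX j).
  rewrite /v /c vE cE [mV N j.+1 _]v'E/=; split => //.
  move: cE; rewrite /mod_cost stat_costE; case: (cost _ _ _) => [y| |]//.
  by rewrite -!EFinN -!EFinD => -[<-]; congr EFin; rewrite /l/=; ring.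
have JclE K : Jcl S kappa K X0 =
    (\sum_(j < K) c j + K%:R * s - l 0%N + l K)%:E.
  elim: K => [|K IH].
    by rewrite /Jcl !big_ord0 mul0r; congr EFin; ring.
  rewrite /Jcl big_ord_recr/= -/(Jcl S kappa K X0) IH.
  have [-> _ _ _] := stepX K.
  by rewrite -EFinD big_ord_recr/= -natr1; congr EFin; ring.
have cb K : 0 <= \sum_(j < K) c j <= v 0%N - v K + K%:R * nuN.
  rewrite sumr_ge0/=; last by move=> j _; have [] := stepX j.
  elim: K => [|K IH]; first by rewrite big_ord0 subrr mul0r addr0.
  have [_ _ _ dec] := stepX K; rewrite big_ord_recr/= -natr1; lra.
apply: (limn_esup_between (c := theta0 + 2 * Clam)) => K K0.
have Kr0 : 0 < K%:R :> R by rewrite ltr0n.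
have /andP[cb0 cb1] := cb K.
have [_ _ /andP[_ v0] _] := stepX 0%N; have [_ _ /andP[vK0 vK] _] := stepX K.
have := lb 0%N; have := lb K; rewrite !ler_norml => /andP[? ?] /andP[? ?].
rewrite JclE -EFinM !lee_fin.
set e := theta0 + 2 * Clam.
have -> : s - e / K%:R = K%:R^-1 * (K%:R * s - e) by field; lra.
have -> : s + nuN + e / K%:R = K%:R^-1 * (K%:R * s + K%:R * nuN + e).
  by field; lra.
by rewrite !ler_pM2l ?invr_gt0// /e; apply/andP; split; lra.
Qed.

End closed_loop.

End dissipative_problem.

(** * Vanishing of the error bound *)

Section rates.
Context {R : realType}.
Variables (alpha gtV glam : R -> R) (gV : R -> R -> R) (C : R).
Hypotheses (alphaKoo : classKoo alpha) (gtVK : classK gtV)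
  (glamK : classK glam).
Hypotheses (gV_gain : horizon_gain gV) (C_gt0 : 0 < C).
Local Notation th := (vartheta alpha C).

Let rate_ge0 (N : nat) : 0 <= C / (N%:R / 12).
Proof. by rewrite divr_ge0 ?divr_ge0 ?(ltW C_gt0). Qed.

Lemma varthetaE (N : nat) : alpha (th (N%:R / 12)) = C / (N%:R / 12).
Proof. by have [] := kinvP alphaKoo (rate_ge0 N). Qed.

Lemma vartheta_ge0 (N : nat) : 0 <= th (N%:R / 12).
Proof. by have [] := kinvP alphaKoo (rate_ge0 N). Qed.

Lemma vartheta_gt0 (N : nat) : (0 < N)%N -> 0 < th (N%:R / 12).
Proof.
move=> N0; rewrite lt_neqAle vartheta_ge0 andbT; apply/eqP => th0.
have := varthetaE N; rewrite -th0; case: alphaKoo => -[_ _ ->] _ /esym/eqP.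
by rewrite gt_eqF// divr_gt0// divr_gt0// ltr0n.
Qed.

Lemma vartheta_cvg0 : (fun N : nat => th (N%:R / 12)) @ \oo --> (0 : R).
Proof.
apply: (@kinv_cvg0 _ alpha (fun N => C / (N%:R / 12))) => //.
apply/cvgrPdist_le => e e0; near=> N.
rewrite sub0r normrN ger0_norm//.
have N0 : 0 < N%:R :> R by rewrite ltr0n; near: N; exact: nbhs_infty_gt.
have Nlarge : 12 * C / e <= N%:R by near: N; exact: nbhs_infty_ger.
rewrite ler_pdivrMr ?divr_gt0//; move: Nlarge; rewrite ler_pdivrMr//; lra.
Unshelve. all: by end_near. Qed.

Lemma gV_vartheta_cvg0 :
  (fun N : nat => gV (N%:R / 2) (th (N%:R / 12))) @ \oo --> (0 : R).
Proof.
have [_ gV0 _ _] := gV_gain.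
pose u (N : nat) : R * R := (N%:R / 2, th (N%:R / 12)).
suff ucvg : u @ \oo --> ((+oo%R, 0^'+) : set_system R * set_system R).
  exact: cvg_comp ucvg gV0.
apply: cvg_pair => /=.
  apply/cvgryPge => A; near=> N; rewrite ler_pdivlMr//.
  by near: N; exact: nbhs_infty_ger.
move=> A /vartheta_cvg0 A0.
change (\forall N \near \oo, A (th (N%:R / 12))).
near=> N.
have thA : 0 < th (N%:R / 12) -> A (th (N%:R / 12)) by near: N; exact: A0.
by apply/thA/vartheta_gt0; near: N; exact: nbhs_infty_gt.
Unshelve. all: by end_near. Qed.

Lemma nu_ge (N : nat) :
  2 * gtV (th (N%:R / 12)) + 2 * glam (th (N%:R / 12))
    + 2 * gV (N%:R / 2) (th (N%:R / 12)) <= nu gtV glam gV th N.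
Proof.
have [gV0 _ _ _] := gV_gain.
have := classK_ge0 gtVK (vartheta_ge0 N).
have := classK_ge0 glamK (vartheta_ge0 N).
have := gV0 _ _ (divr_ge0 (ler0n R N) (ler0n R 2)) (vartheta_ge0 N).
rewrite /nu; lra.
Qed.

Lemma nu_ge0 (N : nat) : 0 <= nu gtV glam gV th N.
Proof.
have [gV0 _ _ _] := gV_gain.
have := classK_ge0 gtVK (vartheta_ge0 N).
have := classK_ge0 glamK (vartheta_ge0 N).
have := gV0 _ _ (divr_ge0 (ler0n R N) (ler0n R 2)) (vartheta_ge0 N).
rewrite /nu; lra.
Qed.

Lemma nu_cvg0 : nu gtV glam gV th @ \oo --> (0 : R).
Proof.
have -> : (0 : R) = 8 * 0 + 4 * 0 + 4 * 0 by ring.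
apply: cvgD; [apply: cvgD|]; apply: cvgM; try exact: cvg_cst.
- by apply: classK_cvg0 vartheta_cvg0 => //; exact: vartheta_ge0.
- by apply: classK_cvg0 vartheta_cvg0 => //; exact: vartheta_ge0.
- exact: gV_vartheta_cvg0.
Qed.

End rates.

(** * Stability and averaged performance of the MPC closed loop *)

Theorem theorem6p10 (R : realType) (dO : measure_display)
  (Om : measurableType dO) (SX SU SW : completeNormedModType R)
  (S : stoch_ocp Om SX SU SW) (Hstanding : standing S)
  (mu : nat -> nat -> (Om -> SX) -> (Om -> SU)) (Hmu : mpc_feedback S mu)
  (d : (Om -> SX) -> (Om -> SX) -> \bar R)
  (Hd : pseudometric_on (@RV R dO Om SX) d)
  (Xs : nat -> Om -> SX) (Us : nat -> Om -> SU)
  (Hs : stationary_pair S Xs Us)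
  (Hls : stat_cost S Xs Us \is a fin_num)
  (lam : nat -> (Om -> SX) -> R) (alpha : R -> R) (Cl : R) (Cl_gt0 : 0 < Cl)
  (Hdiss : strictly_dissipative S Xs Us d lam Cl alpha)
  (r Clam CV : R) (r_gt0 : 0 < r) (Clam_gt0 : 0 < Clam) (CV_gt0 : 0 < CV)
  (Hlam : forall j X, Bbar S Xs d r j X -> `|lam j X| <= Clam)
  (Hcheap : cheaply_reachable S Xs Us d r CV)
  (eps : R) (gV : R -> R -> R) (eps_gt0 : 0 < eps) (HgV : horizon_gain gV)
  (HV : forall N j X, (0 < N)%N -> Bbar S Xs d eps j X ->
    (`| V S N j X - V S N j (Xs j) | <= cmp_ext (gV N%:R) (d X (Xs j)))%E)
  (Hstat0 : forall j, mod_cost S Xs Us lam j (Xs j) (Us j) = 0%E)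
  (teps tr : R) (glam gtV : R -> R) (teps_gt0 : 0 < teps) (tr_ge : teps <= tr)
  (Hglam : classKoo glam) (HgtV : classKoo gtV)
  (Hlamc : forall j X, Bbar S Xs d teps j X ->
    (`| lam j X - lam j (Xs j) |%:E <= cmp_ext glam (d X (Xs j)))%E)
  (HtV : forall N j X, (0 < N)%N -> Bbar S Xs d tr j X ->
    (`| mod_V S Xs Us lam N j X - mod_V S Xs Us lam N j (Xs j) |
       <= cmp_ext gtV (d X (Xs j)))%E)
  (heps : R) (gVoo : R -> R) (heps_gt0 : 0 < heps) (HgVoo : classK gVoo)
  (HVoo : forall j X, Bbar S Xs d heps j X ->
    (`| shift_Voo S Xs Us j X - shift_Voo S Xs Us j (Xs j) |
       <= cmp_ext gVoo (d X (Xs j)))%E) :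
  exists (theta0 : R) (N0 : nat) (delta : R -> R),
    [/\ 0 < theta0, (0 < N0)%N, classL delta,
      (forall N, (N0 <= N)%N ->
        let Y j := mod_V_sublevel S Xs Us lam N j theta0 in
        let Q j := mod_V_sublevel S Xs Us lam N j (delta N%:R) in
        [/\ forward_invariant S (mu N) Y, forward_invariant S (mu N) Q &
          unif_lyapunov S Xs d (mu N) (fun j => Y j `\` Q j)
            (mod_V S Xs Us lam N)]) &
      \forall N \near \oo, forall X0,
        mod_V_sublevel S Xs Us lam N 0 theta0 X0 ->
        (stat_cost S Xs Us
           <= limn_esup (fun K => (K%:R^-1)%:E * Jcl S (mu N) K X0)
           <= stat_cost S Xs Us
              + (nu gtV glam gV (vartheta alpha (Clam + Cl + CV)) N)%:E)%E].
Proof.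
set C := Clam + Cl + CV.
have C0 : 0 < C by rewrite !addr_gt0.
have alphaKoo : classKoo alpha by case: Hdiss.
have aK : classK alpha by case: alphaKoo.
have [[gtVK _] [glamK _]] := (HgtV, Hglam).
(* inside the radius r0 all the local hypotheses are available *)
pose r0 := Num.min r (Num.min eps teps).
have r0_gt0 : 0 < r0 by rewrite !lt_min r_gt0 eps_gt0.
have r0r : r0 <= r by rewrite ge_min lexx.
have r0eps : r0 <= eps by rewrite !ge_min lexx orbT.
have r0teps : r0 <= teps by rewrite !ge_min lexx !orbT.
have r0tr : r0 <= tr by exact: le_trans tr_ge.
pose th (N : nat) := vartheta alpha C (N%:R / 12).
pose nuN := nu gtV glam gV (vartheta alpha C).
have nuN0 N : 0 <= nuN N by exact: nu_ge0.
(* thr N is the level above which alpha of the distance exceeds 2 nuN N *)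
pose thr N := gtV (kinv alpha (2 * nuN N)) + nuN N.
have nu2 N : 0 <= 2 * nuN N by rewrite mulr_ge0.
have kinv0 N := (kinvP alphaKoo (nu2 N)).1.
have thr0 N : 0 <= thr N by rewrite addr_ge0// classK_ge0.
have thr_cvg : thr @ \oo --> (0 : R).
  have nuc : nuN @ \oo --> (0 : R) by exact: nu_cvg0.
  have -> : (0 : R) = 0 + 0 by rewrite addr0.
  apply: cvgD => //; apply: classK_cvg0 => //.
  apply: (@kinv_cvg0 _ alpha (fun N => 2 * nuN N)) => //.
  by rewrite -[X in _ --> X](mulr0 2); apply: cvgM => //; exact: cvg_cst.
have [delta deltaL thr_delta] := classL_dominating thr0 thr_cvg.
pose theta0 := alpha r0.
have theta0_gt0 : 0 < theta0 by exact: classK_gt0.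
have [N0 N0_prop] : exists N0 : nat, forall N, (N0 <= N)%N ->
    [/\ (2 <= N)%N, th N <= r0 & delta N%:R <= theta0].
  have th_cvg : th @ \oo --> (0 : R) by exact: vartheta_cvg0.
  have delta_cvg : (fun N : nat => delta N%:R) @ \oo --> (0 : R).
    by case: deltaL => _ _; exact: cvg_comp cvgr_idn.
  have : \forall N \near \oo,
      [/\ (2 <= N)%N, th N <= r0 & delta N%:R <= theta0].
    near=> N; split.
    - by near: N; exact: nbhs_infty_ge.
    - by near: N; exact: (cvgr_le _ th_cvg).
    - by near: N; exact: (cvgr_le _ delta_cvg).
  by move=> [N0 _ N0_prop]; exists N0 => N N0N; exact: N0_prop.
have all_N N : (N0 <= N)%N ->
    let Y j := mod_V_sublevel S Xs Us lam N j theta0 in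
    let Q j := mod_V_sublevel S Xs Us lam N j (delta N%:R) in
    [/\ forward_invariant S (mu N) Y, forward_invariant S (mu N) Q,
        unif_lyapunov S Xs d (mu N) (fun j => Y j `\` Q j)
          (mod_V S Xs Us lam N) &
        forall X0, Y 0%N X0 -> (stat_cost S Xs Us
           <= limn_esup (fun K => (K%:R^-1)%:E * Jcl S (mu N) K X0)
           <= stat_cost S Xs Us + (nuN N)%:E)%E].
  move=> /N0_prop[N2 thr0r deltar] Y Q.
  have N_gt0 : (0 < N)%N by exact: ltnW.
  have near_Y j X : Y j X -> Bbar S Xs d r0 j X.
    move=> [sX /andP[_ mVX]].
    apply: (near_of_alpha Hstanding Hd Hs Hdiss) => //.
      exact: ltW.
    by apply: le_trans mVX; apply: (alpha_le_mod_V Hstanding Hd Hs Hdiss).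
  have near_Y2 j X : Y j X -> Bbar S Xs d tr j X /\ Bbar S Xs d r j X.
    by move=> /near_Y nX; split; apply: near_mono nX.
  have tV_le j X rho : Bbar S Xs d tr j X -> Bbar S Xs d rho j X ->
      (mod_V S Xs Us lam N j X <= (gtV rho)%:E)%E.
    exact: (mod_V_le_dist Hstanding Hd Hs Hdiss Hstat0 HtV gtVK N_gt0).
  have dec j X : Y j X -> Uad S X (mu N j X) /\
      (mod_V S Xs Us lam N j.+1 (step S j X (mu N j X)) +
        mod_cost S Xs Us lam j X (mu N j X) <=
       mod_V S Xs Us lam N j X + (nuN N)%:E)%E.
    move=> YX; have [_ nrX] := near_Y2 _ _ YX; have [sX _] := YX.
    have [U [adU optU ->]] := Hmu N j X N_gt0 sX; split; first exact: adU.
    have th0 : 0 < th N by exact: vartheta_gt0.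
    have := @mod_V_decrease _ _ _ _ _ _ S Hstanding d Hd Xs Us Hs Hls lam alpha
      Cl Hdiss Hstat0 r Clam CV eps teps tr gV glam gtV Hlam Hcheap HV Hlamc HtV
      HgV glamK gtVK (th N) N j X U N2 th0 (le_trans thr0r r0eps)
      (le_trans thr0r r0teps) (le_trans thr0r r0tr) C0
      (varthetaE alphaKoo C0 N) nrX adU optU.
    move=> /le_trans; apply; apply: leeD2l; rewrite lee_fin.
    exact: nu_ge.
  have thrN := thr_delta N; have thr_theta0 := le_trans thrN deltar.
  split.
  - move=> j X; apply: (invariant_sublevel Hstanding Hd Hs Hdiss alphaKoo HgtV
      N_gt0 tV_le near_Y2 (nuN0 N) dec).
    by rewrite thr_theta0/=.
  - move=> j X; apply: (invariant_sublevel Hstanding Hd Hs Hdiss alphaKoo HgtV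
      N_gt0 tV_le near_Y2 (nuN0 N) dec).
    by rewrite thrN.
  - exact: (lyapunov_sublevel Hstanding Hd Hs Hdiss alphaKoo HgtV N_gt0 tV_le
      near_Y2 (nuN0 N) dec).
  - move=> X0 Y0; rewrite (stat_costE Hls) -EFinD.
    exact: (average_cost Hstanding Hd Hs Hls Hdiss alphaKoo HgtV N_gt0 tV_le
      Hlam near_Y2 (nuN0 N) dec).
exists theta0, N0, delta; split => //.
- by case: (N0_prop N0 (leqnn N0)) => /ltnW.
- by move=> N /all_N[].
- by exists N0 => // N /= /all_N[].
Unshelve. all: by end_near. Qed.
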